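(* Let $z_0\in V=(0,1)^2$ and $R>0$ with $\overline{B_R(z_0)}\subset V$. For a sequence $\eta\to0$ of positive numbers, radii $0<r_\eta\le R$ and open sets $I_\eta\subset(0,1)$, let $\Sigma_Y^\eta=T_{r_\eta,I_\eta}:=((0,1)\setminus I_\eta)\times B_{r_\eta}(z_0)$. Assume $$\eta\,|\ln(r_\eta)|\to0\qquad\text{and}\qquad\eta^{-1}r_\eta^{-2}|I_\eta|\to0 .$$ Then $\Sigma_Y^\eta$ is asymptotically connecting in the direction $e_1$, i.e. there exists a sequence $\Psi_\eta\in\dot H_\#(\operatorname{curl},Z)$ with $$\eta^{1/2}\|\Psi_\eta-e_2\mathbf{1}_{\{x_3>0\}}\|_{L^2(Z^\eta)}\to0,\qquad\eta^{-1/2}\|\operatorname{curl}\Psi_\eta\|_{L^2(Z^\eta)}\to0 ,$$ where $Z^\eta=Z\setminus\Sigma_Y^\eta$.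
   Context: $B_r(z_0)\subset\mathbb{R}^2$ is the disc of radius $r$ around $z_0$, placed in the coordinates $(x_2,x_3)$, so that $T_{r,I}=\{x\in\mathbb{R}^3:x_1\in(0,1)\setminus I,\ (x_2,x_3)\in B_r(z_0)\}$. $I_\eta$ consists of finitely many open intervals (gaps in the wire; $I_\eta=\emptyset$ is allowed) and $|I_\eta|$ is its Lebesgue measure. $Z=(0,1)^2\times\mathbb{R}$. $H_{\mathrm{loc}}(\operatorname{curl},\mathbb{R}^3)$ is the set of $u\in L^2_{\mathrm{loc}}(\mathbb{R}^3,\mathbb{C}^3)$ with distributional curl in $L^2_{\mathrm{loc}}(\mathbb{R}^3,\mathbb{C}^3)$, and $\dot H_\#(\operatorname{curl},Z)$ is the set of restrictions $u|_Z$ of functions $u\in H_{\mathrm{loc}}(\operatorname{curl},\mathbb{R}^3)$ that are $1$-periodic in the directions $e_1$ and $e_2$. Limits are along the sequence $\eta\to0$. *)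

(* Defs.v *)
From HB Require Import structures.
From mathcomp Require Import all_boot all_order all_algebra.
From mathcomp Require Import complex.
From mathcomp Require Import all_classical all_reals all_analysis.
Set Implicit Arguments.
Unset Strict Implicit.
Unset Printing Implicit Defensive.
Import Order.TTheory GRing.Theory Num.Theory.
Import numFieldNormedType.Exports.
Local Open Scope classical_set_scope.
Local Open Scope ring_scope.
Local Open Scope complex_scope.

(* The point (x_1, x_2, x_3) is ((x_1, x_2), x_3); coordinates are numbered
   from 0, so that e_1, e_2, e_3 are [basis3 0], [basis3 1], [basis3 2].
   Measurability is Borel measurability; functions to C^3 are representatives
   of their classes modulo equality almost everywhere.  [measR3] is [R * R * R]
   with the sigma-algebra on which the library puts the Lebesgue measure. *)

Section Definitions.
Variable R : realType.
Local Notation R3 := (R * R * R)%type.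
Local Notation C3 := 'rV[R[i]]_3.

Local Notation measR3 :=
  (measurableTypeR R * measurableTypeR R * measurableTypeR R)%type.

Definition lebesgue3 : {measure set (measR3 : measurableType _) -> \bar R} :=
  ((@lebesgue_measure R \x @lebesgue_measure R) \x @lebesgue_measure R)%E.

Definition basis3 (k : 'I_3) : R3 :=
  (((k == 0)%:R, (k == 1)%:R), (k == 2)%:R).

Definition partial3 (k : 'I_3) (f : R3 -> R) : R3 -> R :=
  fun x => 'D_(basis3 k) f x.

Definition iter_partial3 (s : seq 'I_3) (f : R3 -> R) : R3 -> R :=
  foldr partial3 f s.

Definition smooth3 (f : R3 -> R) : Prop :=
  forall s : seq 'I_3, continuous (iter_partial3 s f) /\
    forall (k : 'I_3) (x : R3), derivable (iter_partial3 s f) x (basis3 k).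

Definition support3 (f : R3 -> R) : set R3 := closure [set x | f x != 0].

Definition test_function (Omega : set R3) (phi : R3 -> R) : Prop :=
  [/\ smooth3 phi, compact (support3 phi) & support3 phi `<=` Omega].

Definition cintegral (D : set R3) (f : R3 -> R[i]) : R[i] :=
  (\int[lebesgue3]_(x in D) complex.Re (f x))
    +i* (\int[lebesgue3]_(x in D) complex.Im (f x)).

Definition enorm (v : C3) : R :=
  Num.sqrt (\sum_(k < 3) ((complex.Re (v 0 k)) ^+ 2 + (complex.Im (v 0 k)) ^+ 2)).

Definition measurable_C3 (D : set R3) (u : R3 -> C3) : Prop :=
  forall k : 'I_3,
    measurable_fun (D : set measR3) (fun x => complex.Re (u x 0 k)) /\
    measurable_fun (D : set measR3) (fun x => complex.Im (u x 0 k)).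

Definition L2norm (D : set R3) (u : R3 -> C3) : \bar R :=
  Lnorm lebesgue3 2%:E ((fun x => (enorm (u x))%:E) \_ D).

Definition L2loc (Omega : set R3) (u : R3 -> C3) : Prop :=
  measurable_C3 Omega u /\
  forall K : set R3, compact K -> K `<=` Omega -> (L2norm K u < +oo)%E.

(* [w] is the distributional curl of [u] on the open set [Omega], and it is in
   L^2_loc.  Indices are cyclic, that is, addition in ['I_3] is modulo 3:
   (curl u)_k = d_(k+1) u_(k+2) - d_(k+2) u_(k+1). *)
Definition is_curl (Omega : set R3) (u w : R3 -> C3) : Prop :=
  L2loc Omega w /\
  forall phi : R3 -> R, test_function Omega phi -> forall k : 'I_3,
    cintegral Omega (fun x => w x 0 k * (phi x)%:C) =
    - cintegral Omega (fun x => u x 0 (k + 2) * (partial3 (k + 1) phi x)%:C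
                              - u x 0 (k + 1) * (partial3 (k + 2) phi x)%:C).

Definition Hloc_curl (u : R3 -> C3) : Prop :=
  L2loc setT u /\ exists w : R3 -> C3, is_curl setT u w.

Definition periodic1 (k : 'I_3) (u : R3 -> C3) : Prop :=
  {ae lebesgue3, forall x, u (x + basis3 k) = u x}.

Definition cylZ : set R3 :=
  [set x | [/\ 0 < x.1.1 < 1 & 0 < x.1.2 < 1]].

(* A function on Z is represented by any function on R^3 extending it. *)
Definition Hdot_per_curl (Psi : R3 -> C3) : Prop :=
  exists u : R3 -> C3,
    [/\ Hloc_curl u, periodic1 0 u, periodic1 1 u &
        forall x, cylZ x -> Psi x = u x].

(* The Euclidean disc; the library's [ball] on [R * R] is a square. *)
Definition disc (r : R) (z : R * R) : set (R * R) :=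
  [set y | (y.1 - z.1) ^+ 2 + (y.2 - z.2) ^+ 2 < r ^+ 2].

Definition wire (z0 : R * R) (r : R) (I : set R) : set R3 :=
  [set x | (`]0, 1[ `\` I) x.1.1 /\ disc r z0 (x.1.2, x.2)].

Definition upper_e2 (x : R3) : C3 :=
  if 0 < x.2 then delta_mx 0 1 else 0.

(* [C n] is the curl of [Psi n] in Z, which is unique almost everywhere. *)
Definition asymptotically_connecting_e1
    (eta : nat -> R) (Sigma : nat -> set R3) : Prop :=
  exists Psi C : nat -> R3 -> C3,
    [/\ forall n, Hdot_per_curl (Psi n),
        forall n, is_curl cylZ (Psi n) (C n),
        ((Num.sqrt (eta n))%:E *
           L2norm (cylZ `\` Sigma n) (Psi n \- upper_e2)%R)%E
          @[n --> \oo] --> 0%E &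
        ((Num.sqrt (eta n))^-1%:E * L2norm (cylZ `\` Sigma n) (C n))%E
          @[n --> \oo] --> 0%E].

Definition finite_union_open_intervals (I : set R) : Prop :=
  exists s : seq (R * R), I = \bigcup_(p in [set` s]) [set` `]p.1, p.2[].

End Definitions.

(* Main.v *)
Require Import Defs.
From HB Require Import structures.
From mathcomp Require Import all_boot all_order all_algebra.
From mathcomp Require Import complex.
From mathcomp Require Import all_classical all_reals all_analysis measurable_realfun.
From mathcomp Require Import ring lra.
Set Implicit Arguments.
Unset Strict Implicit.
Unset Printing Implicit Defensive.
Import Order.TTheory GRing.Theory Num.Theory.
Import numFieldNormedType.Exports.
Local Open Scope classical_set_scope.
Local Open Scope ring_scope.

(** Why the theorem is true.  The gaps of the wire need no special treatment: the fields
   [psi] below do not depend on x_1, and their curl is a current along e_1 confined to the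
   cylinder over the disc of radius r.  Outside the wire this current is seen only inside
   the gaps.  Its total strength is fixed, so its density is of order r^-2, and its squared
   L^2 norm over the gaps is of order r^-4 (|I| r^2) = |I| / r^2, which is o(eta) by
   assumption.

   In the plane of (x_2, x_3) one looks for a field, 1-periodic in x_2, that is close to 0
   far below and to e_2 far above; its curl must have total strength one in each period.
   The field of a line current repeated periodically is known in closed form.  With
   z = (z_2, z_3), p = 2 pi (x_2 - z_2), q = 2 pi (x_3 - z_3) and W = cosh q - cos p (the
   [potential], whose logarithm is harmonic away from its zeros) it is
     (1/2 + sinh q / (2 W)) e_2 - (sin p / (2 W)) e_3.
   The square of its distance to e_2 1_{x_3 > z_3} is exactly e^{-|q|} / (2 W), which decays
   exponentially in |x_3| and behaves like 1 / dist^2 near the axis of the wire.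

   The singularity is removed by replacing 1 / W by [capinv w W], which agrees with 1 / W as
   soon as W >= w and continues it by its tangent line for W <= w.  The new field is C^1
   along the coordinate lines, its curl vanishes where W > w ([psi_curl]), and
   w = r^2 / 2 makes {W < w} lie in the disc of radius r ([disc_of_potential]).  The squared
   distance to e_2 1_{x_3 > z_3} is at most [capinv w W] ([psi_error]), which is at most a
   constant times 1 / (dist^2 + r^2) ([capinv_cell_le]).  The integral of the latter over a
   period cell is of order 1 + |ln r| ([psi_error_L2]), which multiplied by eta tends to 0;
   the strip 0 < x_3 < z_3, where the two indicator functions differ, costs only O(eta).

   All components being continuous with continuous partial derivatives, the distributional
   curl is the classical one ([classical_curl]); this is Fubini's theorem and, on each line
   parallel to an axis, the fundamental theorem of calculus. *)

(** * Hyperbolic functions and bounds for the cosine *)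
Section hyperbolic.
Context {R : realType}.
Implicit Types x y : R.

Definition cosh x := (expR x + expR (- x)) / 2.
Definition sinh x := (expR x - expR (- x)) / 2.

Lemma expRNK x : expR x * expR (- x) = 1.
Proof. by rewrite -expRD subrr expR0. Qed.

Lemma cosh2Bsinh2 x : cosh x ^+ 2 - sinh x ^+ 2 = 1.
Proof.
by rewrite -(expRNK x) /cosh /sinh; field.
Qed.

Lemma coshN x : cosh (- x) = cosh x.
Proof. by rewrite /cosh opprK addrC. Qed.

Lemma sinhN x : sinh (- x) = - sinh x.
Proof. by rewrite /sinh opprK -mulNr opprB. Qed.

Lemma coshBsinh x : cosh x - sinh x = expR (- x).
Proof. by rewrite /cosh /sinh; field. Qed.

Global Instance is_derive_cosh x : is_derive x 1 cosh (sinh x).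
Proof.
rewrite /cosh.
have h : is_derive x 1 (fun y => expR (- y)) (expR (- x) * -1).
  exact: (@is_derive1_comp _ expR -%R).
have -> : (fun y => (expR y + expR (- y)) / 2) =
          2^-1 *: (expR \+ (fun y => expR (- y))).
  by apply/funext => y /=; rewrite fctE /= mulrC.
apply: is_derive_eq.
by rewrite /sinh mulrN1 -[_ *: _]/(_ * _) mulrC.
Qed.

Global Instance is_derive_sinh x : is_derive x 1 sinh (cosh x).
Proof.
rewrite /sinh.
have h : is_derive x 1 (fun y => expR (- y)) (expR (- x) * -1).
  exact: (@is_derive1_comp _ expR -%R).
have -> : (fun y => (expR y - expR (- y)) / 2) =
          2^-1 *: (expR \- (fun y => expR (- y))).
  by apply/funext => y /=; rewrite fctE /= mulrC.
apply: is_derive_eq.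
by rewrite /cosh mulrN1 opprK -[_ *: _]/(_ * _) mulrC.
Qed.

(** By evenness take x >= 0.  With y = x / 2, cosh x - 1 = (e^y - e^{-y})^2 / 2, and
   e^y - e^{-y} >= (1 + y) - 1. *)
Lemma cosh_lower x : 1 + x ^+ 2 / 8 <= cosh x.
Proof.
wlog x0 : x / 0 <= x.
  move=> h; have [/h//|/ltW] := leP 0 x.
  by rewrite -oppr_ge0 => /h; rewrite coshN sqrrN.
have e1 := expR_ge1Dx (x / 2).
have e2 : expR (- (x / 2)) <= 1 by rewrite -[leRHS]expR0 ler_expR; lra.
have -> : cosh x = 1 + (expR (x / 2) - expR (- (x / 2))) ^+ 2 / 2.
  have h := expRNK (x / 2).
  have -> : (expR (x / 2) - expR (- (x / 2))) ^+ 2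
    = expR (x/2) * expR (x/2) + expR (-(x/2)) * expR (-(x/2))
      - 2 * (expR (x / 2) * expR (- (x / 2))) by ring.
  rewrite h -!expRD /cosh.
  have -> : x / 2 + x / 2 = x by field.
  have -> : - (x / 2) + - (x / 2) = - x by field.
  by field.
nra.
Qed.

Lemma cosh_ge1 x : 1 <= cosh x.
Proof. apply: le_trans (cosh_lower x); nra. Qed.

Lemma sinh_ge0 x : 0 <= x -> 0 <= sinh x.
Proof.
move=> x0; rewrite /sinh divr_ge0// subr_ge0 ler_expR; lra.
Qed.

End hyperbolic.

Section sine_bound.
Context {R : realType}.
Implicit Types x y : R.

Lemma ge0_of_derive_ge0 (f df : R -> R) x : (forall y, is_derive y 1 f (df y)) ->
  f 0 = 0 -> (forall y, 0 <= y -> 0 <= df y) -> 0 <= x -> 0 <= f x.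
Proof.
move=> fdf f0 df0 x0; rewrite -f0.
apply: (@ger0_derive1_le_cc _ f 0 x) => //.
- move=> y; rewrite in_itv/= => /andP[/ltW y0 _].
  by rewrite derive1E derive_val df0.
- apply: continuous_subspaceT => y; apply: differentiable_continuous.
  exact/derivable1_diffP.
- by rewrite in_itv/= lexx.
- by rewrite in_itv/= x0 lexx.
Qed.

Lemma sin_le_id x : 0 <= x -> sin x <= x.
Proof.
move=> x0; rewrite -subr_ge0.
apply: (@ge0_of_derive_ge0 (fun y => y - sin y) (fun y => 1 - cos y)) => //.
by rewrite sin0 subr0.
Qed.

Lemma cos_lower x : 0 <= x -> 1 - x ^+ 2 / 2 <= cos x.
Proof.
move=> x0; rewrite -subr_ge0.
apply: (@ge0_of_derive_ge0 (fun y => cos y - (1 - y ^+ 2 / 2)) (fun y => y - sin y)) => //.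
- move=> y; apply: is_derive_eq.
  by rewrite /GRing.scale /=; field.
  by rewrite cos0; lra.
- by move=> y y0; rewrite subr_ge0 sin_le_id.
Qed.

(** The Taylor bounds for sine and cosine follow from one another by integration from 0. *)
Lemma sin_lower x : 0 <= x -> x - x ^+ 3 / 6 <= sin x.
Proof.
move=> x0; rewrite -subr_ge0.
apply: (@ge0_of_derive_ge0 (fun y => sin y - (y - y ^+ 3 / 6))
  (fun y => cos y - (1 - y ^+ 2 / 2))) => //.
- move=> y; apply: is_derive_eq.
  by rewrite /GRing.scale /=; field.
- by rewrite sin0; lra.
- by move=> y y0; rewrite subr_ge0 cos_lower.
Qed.

(** By 1 - cos (2u) = 2 sin^2 u with u = pi x in [0, 2], where [sin_lower] gives
   sin u >= u / 3; only 2 <= pi <= 4 is used. *)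
Lemma onem_cos_lower x : `|x| <= 1 / 2 -> 8 / 9 * x ^+ 2 <= 1 - cos (2 * pi * x).
Proof.
wlog x0 : x / 0 <= x.
  move=> h; have [/h//|/ltW] := leP 0 x.
  by rewrite -oppr_ge0 => /h; rewrite mulrN cosN sqrrN normrN.
rewrite ger0_norm// => x2.
have pi2 := @pi_ge2 R; have pi4 := @pihalf_lt2 R.
set u := pi * x.
have u0 : 0 <= u by rewrite mulr_ge0// pi_ge0.
have u2 : u <= 2 by rewrite /u; nra.
have su : u / 3 <= sin u.
  apply: le_trans (sin_lower u0).
  have -> : u - u ^+ 3 / 6 = u * (1 - u ^+ 2 / 6) by field.
  by apply: ler_pM => //; nra.
have -> : 2 * pi * x = u *+ 2 by rewrite /u; ring.
rewrite cos_mulr2n cos2sin2.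
have -> : 1 - ((1 - sin u ^+ 2) *+ 2 - 1) = 2 * sin u ^+ 2 by ring.
have ux : 2 * x <= u by rewrite /u ler_wpM2r.
have : (2 * x / 3) ^+ 2 <= sin u ^+ 2 by rewrite ler_sqr ?nnegrE; nra.
nra.
Qed.

End sine_bound.

(** * A truncation of the inverse that stays differentiable *)
Section capped_inverse.
Context {R : realType}.
Implicit Types t w x : R.

(** A quadratic remainder can be checked across the break point of a function defined by
   cases, where the two one-sided derivatives would otherwise have to be matched. *)
Lemma is_derive_quadratic (f : R -> R) (a l K : R) :
  (forall x, `|f x - f a - l * (x - a)| <= K * (x - a) ^+ 2) ->
  is_derive a 1 f l.
Proof.
move=> fK.
have K0 : 0 <= K.
  have := le_trans (normr_ge0 _) (fK (a + 1)).
  have -> : a + 1 - a = 1 by rewrite addrC addKr.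
  by rewrite expr1n mulr1.
suff h : h^-1 *: (f (h *: 1 + a) - f a) @[h --> 0^'] --> l.
  by apply: DeriveDef; [apply/cvg_ex; exists l|exact: cvg_lim].
apply/cvgrPdist_le => e e0; near=> h.
have h0 : h != 0 by near: h; exact: nbhs_dnbhs_neq.
have hlt : `|h| <= e / (K + 1).
  by near: h; apply: dnbhs0_le; rewrite divr_gt0// ltr_wpDl.
rewrite /GRing.scale /= mulr1.
have -> : l - h^-1 * (f (h + a) - f a) =
   - (h^-1 * (f (h + a) - f a - l * (h + a - a))) by field.
rewrite normrN normrM normfV ler_pdivrMl ?normr_gt0//.
apply: le_trans (fK _) _; rewrite addrK -real_normK ?num_real// expr2 mulrCA ler_wpM2l//.
rewrite ler_pdivlMr ?ltr_wpDl// in hlt.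
apply: le_trans hlt.
by rewrite mulrC ler_wpM2l// lerDl.
Unshelve. all: by end_near. Qed.

(** Equal to [t^-1] for [t >= w], and to the tangent line of the inverse at [w] for
   [t <= w]. *)
Definition capinv w t := (2 * Num.max t w - t) / Num.max t w ^+ 2.

Lemma is_derive_capinv w t : 0 < w ->
  is_derive t 1 (capinv w) (- (Num.max t w ^- 2)).
Proof.
move=> w0; apply: (@is_derive_quadratic _ _ _ (2 / w ^+ 3)) => x.
rewrite /capinv.
(* The four cases are the positions of [x] and [t] relative to [w]; 2 / w^3 bounds the
   second derivative of the inverse above [w]. *)
have w3 : 0 < w ^+ 3 by rewrite exprn_gt0.
have [xw|/ltW wx] := leP x w; have [tw|/ltW wt] := leP t w.
- have -> : (2 * w - x) / w ^+ 2 - (2 * w - t) / w ^+ 2 - - w ^- 2 * (x - t) = 0.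
    by field; lra.
  by rewrite normr0 mulr_ge0 ?sqr_ge0// divr_ge0// ltW.
- have t0 : 0 < t by lra.
  have -> : (2 * w - x) / w ^+ 2 - (2 * t - t) / t ^+ 2 - - t ^- 2 * (x - t)
    = (t - w) * ((w - x) * t + (t - x) * w) / (w ^+ 2 * t ^+ 2).
    by field; lra.
  have wt0 : 0 < w ^+ 2 * t ^+ 2 by rewrite mulr_gt0// exprn_gt0.
  have p1 : 0 <= (w - x) * t by rewrite mulr_ge0; lra.
  have p2 : 0 <= (t - x) * w by rewrite mulr_ge0; lra.
  rewrite ger0_norm; last by rewrite divr_ge0 ?(ltW wt0)// mulr_ge0; lra.
  rewrite ler_pdivrMr//.
  have -> : 2 / w ^+ 3 * (x - t) ^+ 2 * (w ^+ 2 * t ^+ 2) =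
    2 * t ^+ 2 * (x - t) ^+ 2 / w by field; lra.
  rewrite ler_pdivlMr//.
  have h1 : (t - w) * w <= (t - x) * t by nra.
  have h2 : (w - x) * t + (t - x) * w <= 2 * ((t - x) * t) by nra.
  have -> : (t - w) * ((w - x) * t + (t - x) * w) * w =
    ((t - w) * w) * ((w - x) * t + (t - x) * w) by ring.
  have -> : 2 * t ^+ 2 * (x - t) ^+ 2 = ((t - x) * t) * (2 * ((t - x) * t)) by ring.
  by apply: ler_pM => //; rewrite ?mulr_ge0; lra.
- have x0 : 0 < x by lra.
  have -> : (2 * x - x) / x ^+ 2 - (2 * w - t) / w ^+ 2 - - w ^- 2 * (x - t)
    = (x - w) ^+ 2 / (x * w ^+ 2) by field; lra.
  have xw0 : 0 < x * w ^+ 2 by rewrite mulr_gt0// exprn_gt0.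
  rewrite ger0_norm; last by rewrite divr_ge0 ?(ltW xw0)// sqr_ge0.
  rewrite ler_pdivrMr//.
  have -> : 2 / w ^+ 3 * (x - t) ^+ 2 * (x * w ^+ 2) =
    2 * x * (x - t) ^+ 2 / w by field; lra.
  rewrite ler_pdivlMr// mulrC.
  have h : (x - w) ^+ 2 <= (x - t) ^+ 2 by rewrite ler_sqr ?nnegrE; lra.
  by apply: ler_pM => //; nra.
- have x0 : 0 < x by lra.
  have t0 : 0 < t by lra.
  have -> : (2 * x - x) / x ^+ 2 - (2 * t - t) / t ^+ 2 - - t ^- 2 * (x - t)
    = (x - t) ^+ 2 / (x * t ^+ 2) by field; lra.
  have xt0 : 0 < x * t ^+ 2 by rewrite mulr_gt0// exprn_gt0.
  rewrite ger0_norm; last by rewrite divr_ge0 ?(ltW xt0)// sqr_ge0.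
  rewrite mulrC ler_wpM2r ?sqr_ge0//.
  have h : w ^+ 3 <= x * t ^+ 2.
    rewrite exprS; apply: ler_pM; rewrite ?sqr_ge0 ?(ltW w0)//.
    by rewrite ler_sqr ?nnegrE ?(ltW w0) ?(ltW t0).
  have : (x * t ^+ 2)^-1 <= (w ^+ 3)^-1.
    by rewrite lef_pV2// posrE; nra.
  have := invr_gt0 (w ^+ 3); rewrite w3 => ?; lra.
Qed.

Lemma continuous_max_cst w : continuous (fun t => Num.max t w).
Proof.
move=> t; apply: continuous_max; [exact: cvg_id|exact: cvg_cst].
Qed.

Lemma capinv_ge0 w t : 0 <= t -> 0 <= capinv w t.
Proof.
move=> t0.
have tM : t <= Num.max t w by rewrite le_max lexx.
by rewrite /capinv divr_ge0 ?sqr_ge0//; lra.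
Qed.

(** With the next two bounds: [capinv w t] is comparable with the inverse of [max t w], and
   at most that of [t]. *)
Lemma capinv_le w t : 0 < w -> 0 <= t -> capinv w t <= 2 / Num.max t w.
Proof.
move=> w0 t0.
have M0 : 0 < Num.max t w by rewrite lt_max w0 orbT.
rewrite /capinv; have -> : 2 / Num.max t w = 2 * Num.max t w / Num.max t w ^+ 2.
  by field; lra.
by rewrite ler_wpM2r ?invr_ge0 ?sqr_ge0//; lra.
Qed.

Lemma capinvM_le1 w t : 0 < w -> capinv w t * t <= 1.
Proof.
move=> w0.
have M0 : 0 < Num.max t w by rewrite lt_max w0 orbT.
rewrite /capinv mulrAC ler_pdivrMr ?exprn_gt0//.
have := sqr_ge0 (Num.max t w - t); nra.
Qed.

Lemma capinv_max_ge1 w t : 0 < w -> 1 <= capinv w t * Num.max t w.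
Proof.
move=> w0.
have M0 : 0 < Num.max t w by rewrite lt_max w0 orbT.
have tM : t <= Num.max t w by rewrite le_max lexx.
by rewrite /capinv mulrAC ler_pdivlMr ?exprn_gt0//; nra.
Qed.

End capped_inverse.

(** * Integration on R^3 *)
Section integral_monotone.
Local Open Scope ereal_scope.

(** The integral of a nonnegative function is a supremum over the simple functions below it,
   hence monotone even for functions that are not measurable. *)
Lemma ge0_le_integralT d (T : measurableType d) (R : realType)
    (mu : {measure set T -> \bar R}) (f g : T -> \bar R) :
  (forall x, 0 <= f x) -> (forall x, f x <= g x) ->
  \int[mu]_x f x <= \int[mu]_x g x.
Proof.
move=> f0 fg; rewrite !ge0_integralTE//; last first.
  by move=> x; exact: le_trans (fg x).
by apply: le_ereal_sup => _ [h /= hf <-]; exists h => //= x; exact: le_trans (fg x).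
Qed.

End integral_monotone.

Section space.
Context {R : realType}.
Local Notation R3 := (R * R * R)%type.
Local Notation measR3 :=
  (measurableTypeR R * measurableTypeR R * measurableTypeR R)%type.

(** An open set is the union of the countably many boxes with rational vertices that it
   contains. *)
Lemma open_measurable3 (U : set R3) : open U -> measurable (U : set measR3).
Proof.
move=> oU.
pose box (i : (rat * rat) * (rat * rat) * (rat * rat)) : set R3 :=
  (`](ratr i.1.1.1), (ratr i.1.1.2)[%classic `*` `](ratr i.1.2.1), (ratr i.1.2.2)[%classic)
    `*` `](ratr i.2.1), (ratr i.2.2)[%classic.
have -> : U = \bigcup_i (if `[< box i `<=` U >] then box i else set0).
  apply/seteqP; split => [x Ux|x [i _]]; last first.
    by case: asboolP => // + bx; exact.
  have /nbhs_ballP[e /= e0 xeU] : nbhs x U by move: oU; rewrite openE; exact.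
  have q (t : R) : exists p : rat * rat,
      t - e < ratr p.1 /\ ratr p.1 < t /\ t < ratr p.2 /\ ratr p.2 < t + e.
    have /rat_in_itvoo[p1] : t - e < t by lra.
    have /rat_in_itvoo[p2] : t < t + e by lra.
    rewrite !in_itv/= => /andP[? ?] /andP[? ?]; exists (p1, p2) => /=; split=> //.
  have [p1 [a1 [b1 [c1 d1]]]] := q x.1.1.
  have [p2 [a2 [b2 [c2 d2]]]] := q x.1.2.
  have [p3 [a3 [b3 [c3 d3]]]] := q x.2.
  exists ((p1, p2), p3) => //.
  have bU : box ((p1, p2), p3) `<=` U.
    move=> y [[]] /=; rewrite !in_itv/= => /andP[? ?] /andP[? ?] /andP[? ?].
    apply: xeU; split; first split.
    - by rewrite /ball /= ltr_norml; lra.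
    - by rewrite /ball /= ltr_norml; lra.
    - by rewrite /ball /= ltr_norml; lra.
  case: asboolP => // _; split; first split; rewrite /= in_itv/=; exact/andP.
apply: countable_bigcupT_measurable => // i.
case: ifP => // _; apply: measurableX => //.
exact: measurableX.
Qed.

Lemma continuous_measurable3 (f : R3 -> R) :
  continuous f -> measurable_fun setT (f : measR3 -> R).
Proof.
move=> /continuousP cf; apply: (measurability _ (measurable_realfun.RGenOpens.measurableE R)).
move=> _ [_ [a [b ->] <-]]; rewrite setTI; apply: open_measurable3.
exact/cf/interval_open.
Qed.

End space.

Section integrability.

Lemma integrable_bounded d (T : measurableType d) (R : realType)
    (mu : {measure set T -> \bar R}) (A : set T) (f : T -> R) (C : R) :
  measurable A -> (mu A < +oo)%E -> measurable_fun setT f ->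
  (forall x, A x -> `|f x| <= C) -> (forall x, ~ A x -> f x = 0) ->
  mu.-integrable setT (EFin \o f).
Proof.
move=> mA Aoo mf fC fA; apply/integrableP; split; first exact/measurable_EFinP.
apply: (@le_lt_trans _ _ (\int[mu]_x (`|C| * \1_A x)%:E)%E).
  apply: ge0_le_integralT => x //=; rewrite lee_fin indicE.
  have [Ax|nAx] := pselect (A x).
    by rewrite mem_set// mulr1 (le_trans (fC _ Ax))// ler_norm.
  by rewrite memNset// mulr0 fA// normr0.
under eq_integral do rewrite EFinM.
rewrite ge0_integralZl//; first by rewrite integral_indic// setIT lte_mul_pinfty.
- exact/measurable_EFinP/measurable_indic.
Qed.

End integrability.

Section cube.
Context {R : realType}.
Local Notation R3 := (R * R * R)%type.
Local Notation measR3 :=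
  (measurableTypeR R * measurableTypeR R * measurableTypeR R)%type.
Local Notation lam := (@lebesgue_measure R).
Implicit Types (h H f : R3 -> R) (M : R).

Definition segm M : set R := `[- M, M]%classic.
Definition square M : set (R * R) := segm M `*` segm M.
Definition cube M : set R3 := square M `*` segm M.

Lemma compact_cube M : compact (cube M).
Proof. by apply: compact_setX; [apply: compact_setX|]; exact: segment_compact. Qed.

Lemma compact_sub_cube (K : set R3) : compact K -> exists2 M, 0 < M & K `<=` cube M.
Proof.
move=> /compact_bounded/pinfty_ex_gt0[M M0 KM]; exists M => // x /KM xM.
have : `|x.1.1| <= M /\ `|x.1.2| <= M /\ `|x.2| <= M.
  move: xM; rewrite /= /Num.norm /= /Num.norm /= !ge_max => /andP[/andP[? ?] ?].
  by split.
rewrite !ler_norml => -[a [b c]].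
by split; [split|]; rewrite /segm /= in_itv.
Qed.

Lemma measurable_segm M : measurable (segm M).
Proof. exact: measurable_itv. Qed.

Lemma measurable_square M :
  measurable (square M : set (measurableTypeR R * measurableTypeR R)%type).
Proof. by apply: measurableX; exact: measurable_segm. Qed.

Lemma measurable_cube M : measurable (cube M : set measR3).
Proof. by apply: measurableX; [exact: measurable_square|exact: measurable_segm]. Qed.

Lemma lebesgue_itvN_lty M : (lam (segm M) < +oo)%E.
Proof. by rewrite /segm lebesgue_measure_itv/=; case: ifP => // _; rewrite -EFinB ltry. Qed.

Lemma lebesgue_square_lty M : ((lam \x lam)%E (square M) < +oo)%E.
Proof.
rewrite /square product_measure1E; [|exact: measurable_segm..].
by rewrite lte_mul_pinfty ?lebesgue_itvN_lty// ge0_fin_numE// lebesgue_itvN_lty.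
Qed.

Lemma lebesgue3_setX (A : set (measurableTypeR R * measurableTypeR R)%type)
    (B : set (measurableTypeR R)) : measurable A -> measurable B ->
  (lebesgue3 R (A `*` B) = (lam \x lam) A * lam B)%E.
Proof. by move=> mA mB; exact: (product_measure1E (lam \x lam)%E lam). Qed.

Lemma lebesgue3_box (A B C : set (measurableTypeR R)) :
  measurable A -> measurable B -> measurable C ->
  (lebesgue3 R ((A `*` B) `*` C) = lam A * lam B * lam C)%E.
Proof.
move=> mA mB mC; rewrite lebesgue3_setX//; last exact: measurableX.
by congr (_ * _)%E; exact: (product_measure1E lam lam).
Qed.

Lemma lebesgue_cube_lty M : (lebesgue3 R (cube M) < +oo)%E.
Proof.
rewrite /cube lebesgue3_setX; [|exact: measurable_square|exact: measurable_segm].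
by rewrite lte_mul_pinfty ?lebesgue_itvN_lty// ge0_fin_numE// lebesgue_square_lty.
Qed.

Lemma continuous_bounded_cube f M : continuous f ->
  exists C, forall x, cube M x -> `|f x| <= C.
Proof.
move=> cf; have /continuous_compact : {within cube M, continuous f}.
  exact: continuous_subspaceT.
move=> /(_ (@compact_cube M))/compact_bounded/pinfty_ex_gt0[C _ hC].
by exists C => x Mx; apply: hC; exists x.
Qed.

Lemma continuous_cube_integrable f M : continuous f ->
  (forall x, ~ cube M x -> f x = 0) -> (lebesgue3 R).-integrable setT (EFin \o f).
Proof.
move=> cf fM; have [C fC] := continuous_bounded_cube M cf.
apply: (@integrable_bounded _ _ R (lebesgue3 R) (cube M) f C) => //.
- exact: measurable_cube.
- exact: lebesgue_cube_lty.
- exact: continuous_measurable3.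
Qed.

Lemma integral_derivative_eq0 (g dg : R -> R) M : continuous dg ->
  (forall s : R, is_derive s 1 g (dg s)) ->
  (forall s, M < `|s| -> g s = 0) -> (forall s, M < `|s| -> dg s = 0) ->
  (\int[lam]_s (dg s)%:E = 0)%E.
Proof.
move=> cdg gdg g0 dg0; pose N : R := `|M| + 1.
have N0 : 0 < N by rewrite ltr_wpDl.
have MN : M < N by rewrite (le_lt_trans (ler_norm _))// ltrDl.
have out s : ~ segm N s -> M < `|s|.
  rewrite /segm /= in_itv/= -ler_norml => /negP; rewrite -ltNge; exact: lt_trans.
have cg : continuous g.
  by move=> s; apply: differentiable_continuous; apply/derivable1_diffP.
transitivity (\int[lam]_(s in segm N) (dg s)%:E)%E.
  rewrite [RHS]integral_mkcond; apply: eq_integral => s _.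
  rewrite patchE; case: ifPn => // /negP sN; rewrite dg0// out// => h.
  by apply: sN; rewrite inE.
rewrite (@continuous_FTC2 _ dg g).
- by rewrite !g0 ?normrN ?(gtr0_norm N0)// subee.
- by rewrite gtrN.
- exact: continuous_subspaceT.
- split; first by [].
    exact/cvg_at_right_filter/cg.
  exact/cvg_at_left_filter/cg.
- by move=> s _; rewrite derive1E derive_val.
Qed.

(** A name of its own lets the measure carry the sigma-finite structure that Fubini's
   theorem asks of the first factor of [lebesgue3]. *)
Definition lebesgue2 : set (measurableTypeR R * measurableTypeR R)%type -> \bar R :=
  (lam \x lam)%E.
HB.instance Definition _ := Measure.copy lebesgue2 (lam \x lam)%E.

Lemma lebesgue2_sigma_finite : sigma_finite setT lebesgue2.
Proof.
exists (fun n => square n%:R) => [|n]; last first.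
  by split; [exact: measurable_square|exact: lebesgue_square_lty].
apply/esym/seteqP; split => // x _.
have := archi_boundP (addr_ge0 (normr_ge0 x.1) (normr_ge0 x.2)).
set n := Num.bound _ => xn; exists n => //.
have := normr_ge0 x.1; have := normr_ge0 x.2 => ? ?.
by split; rewrite /segm /= in_itv/= -ler_norml; lra.
Qed.

HB.instance Definition _ :=
  Measure_isSigmaFinite.Build _ _ _ lebesgue2 lebesgue2_sigma_finite.

Lemma lebesgue3E : lebesgue3 R = (lebesgue2 \x lam)%E.
Proof. by []. Qed.

Definition upd3 (k : 'I_3) (x : R3) (s : R) : R3 :=
  if k == 0 then ((s, x.1.2), x.2) else
  if k == 1 then ((x.1.1, s), x.2) else (x.1, s).

Definition coord3 (k : 'I_3) (x : R3) : R :=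
  if k == 0 then x.1.1 else if k == 1 then x.1.2 else x.2.

Lemma I3_cases (k : 'I_3) : [\/ k = 0, k = 1 | k = 2].
Proof.
case: k => [[|[|[|//]]] i]; [apply: Or31|apply: Or32|apply: Or33]; exact: val_inj.
Qed.

Lemma shift_basis3 k (x : R3) (t : R) :
  t *: basis3 R k + x = upd3 k x (t *: 1 + coord3 k x).
Proof.
rewrite /upd3 /coord3; case: x => [[a b] c].
by have [->|->|->] := I3_cases k; rewrite /basis3 /=;
  congr (_, _, _); rewrite //= ?scaler0 ?add0r.
Qed.

Lemma upd3_coord3 k (x : R3) : upd3 k x (coord3 k x) = x.
Proof. by case: x => [[a b] c]; have [->|->|->] := I3_cases k. Qed.

Lemma coord3_upd3 k (x : R3) s : coord3 k (upd3 k x s) = s.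
Proof. by case: x => [[a b] c]; have [->|->|->] := I3_cases k. Qed.

Lemma upd3_upd3 k (x : R3) s t : upd3 k (upd3 k x s) t = upd3 k x t.
Proof. by case: x => [[a b] c]; have [->|->|->] := I3_cases k. Qed.

Lemma is_derive_slice k f (x : R3) d :
  is_derive (coord3 k x) 1 (fun s => f (upd3 k x s)) d <->
  is_derive x (basis3 R k) f d.
Proof.
have E : (fun t : R => t^-1 *: (((fun s => f (upd3 k x s)) \o shift (coord3 k x)) (t *: 1)
             - f (upd3 k x (coord3 k x))))
       = (fun t : R => t^-1 *: ((f \o shift x) (t *: basis3 R k) - f x)).
  by apply/funext => t; rewrite /= upd3_coord3 shift_basis3.
split => -[c e]; apply: DeriveDef; move: c e; rewrite /derivable /derive /= ?E //.
Qed.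

Lemma continuous_upd3 k (x : R3) : continuous (upd3 k x).
Proof.
have cc (T : topologicalType) (c : T) : continuous (fun _ : R => c).
  by move=> s; exact: cvg_cst.
have ci : continuous (fun s : R => s) by move=> s; exact: cvg_id.
move=> s; have [->|->|->] := I3_cases k; rewrite /upd3 /=.
- exact: (cvg_pair (cvg_pair (ci s) (cc _ x.1.2 s)) (cc _ x.2 s)).
- exact: (cvg_pair (cvg_pair (cc _ x.1.1 s) (ci s)) (cc _ x.2 s)).
- exact: (cvg_pair (cc _ x.1 s) (ci s)).
Qed.

End cube.

(** * Integration by parts and distributional curls *)
Section weak_derivatives.
Context {R : realType}.
Local Notation R3 := (R * R * R)%type.
Local Notation C3 := 'rV[R[i]]_3.
Local Notation measR3 :=
  (measurableTypeR R * measurableTypeR R * measurableTypeR R)%type.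
Local Notation lam := (@lebesgue_measure R).
Implicit Types (f phi : R3 -> R) (M : R) (k : 'I_3).

Lemma fubini3_12 f : (lebesgue3 R).-integrable setT (EFin \o f) ->
  (\int[lebesgue3 R]_x (f x)%:E =
   \int[lebesgue2]_a \int[lam]_s (f (a, s))%:E)%E.
Proof. by rewrite lebesgue3E => h; rewrite -(integral12_prod_meas1 h). Qed.

Lemma fubini3_21 f : (lebesgue3 R).-integrable setT (EFin \o f) ->
  (\int[lebesgue3 R]_x (f x)%:E =
   \int[lam]_s \int[lebesgue2]_a (f (a, s))%:E)%E.
Proof. by rewrite lebesgue3E => h; rewrite -(integral21_prod_meas1 h). Qed.

(** Fubini's theorem with the variable of index [k] innermost. *)
Lemma integral_slices_eq0 k f M : continuous f ->
  (forall x, ~ cube M x -> f x = 0) ->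
  (forall x, \int[lam]_s (f (upd3 k x s))%:E = 0)%E ->
  (\int[lebesgue3 R]_x (f x)%:E = 0)%E.
Proof.
move=> cf f0 f_slice.
have intf := continuous_cube_integrable cf f0.
have [k2|k2] : k = 2 \/ k = 0 \/ k = 1.
- by have [] := I3_cases k => ->; [right; left|right; right|left].
- rewrite (fubini3_12 intf); apply: integral0_eq => a _.
  by rewrite -(f_slice (a, 0)) k2.
rewrite (fubini3_21 intf); apply: integral0_eq => c _.
have intc : (@lebesgue2 R).-integrable setT (fun a => (f (a, c))%:E).
  have [C fC] := continuous_bounded_cube M cf.
  apply: (@integrable_bounded _ _ R (@lebesgue2 R) (square M) (fun a => f (a, c)) `|C|).
  - exact: measurable_square.
  - exact: lebesgue_square_lty.
  - apply: (measurableT_comp (continuous_measurable3 cf)).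
    exact: pair2_measurable.
  - move=> a aM; have [cM|cM] := pselect (segm M c).
      by apply: le_trans (ler_norm _); exact: fC.
    by rewrite f0 ?normr0// => -[].
  - by move=> a aM; rewrite f0// => -[].
case: k2 => k01.
- rewrite -(integral21_prod_meas1 intc); apply: integral0_eq => b _.
  by rewrite /fubini_G -(f_slice ((0, b), c)) k01.
- rewrite -(integral12_prod_meas1 intc); apply: integral0_eq => a _.
  by rewrite /fubini_F -(f_slice ((a, 0), c)) k01.
Qed.

Lemma support3_off phi x : ~ support3 phi x -> phi x = 0.
Proof. by move=> sx; apply/eqP/negPn/negP => px; apply: sx; exact: subset_closure. Qed.

Lemma partial3_off k phi x : ~ support3 phi x -> partial3 k phi x = 0.
Proof.
move=> sx; rewrite /partial3 -(derive_cst (0 : R) x (basis3 R k)).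
apply: near_eq_derive.
have : open (~` support3 phi) by apply: closed_openC; exact: closed_closure.
rewrite openE => /(_ x sx); apply: filterS => y; exact: support3_off.
Qed.

Lemma coord_cube k M x : cube M x -> `|coord3 k x| <= M.
Proof.
rewrite ler_norml; case: x => [[a b] c] [[]] /=.
by rewrite /segm /= !in_itv/=; have [->|->|->] := I3_cases k.
Qed.

Section fixed_test_function.
Variables (phi : R3 -> R) (test : test_function setT phi).
Let sm : smooth3 phi. Proof. by case: test. Qed.

Lemma test_continuous : continuous phi.
Proof. exact: (sm [::]).1. Qed.

Lemma test_partial_continuous k : continuous (partial3 k phi).
Proof. exact: (sm [:: k]).1. Qed.

Lemma test_is_derive k x : is_derive x (basis3 R k) phi (partial3 k phi x).
Proof. by apply: DeriveDef => //; exact: (sm [::]).2. Qed.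

Lemma test_cube : exists M, forall x, ~ cube M x -> phi x = 0 /\ forall k, partial3 k phi x = 0.
Proof.
case: test => _ /compact_sub_cube[M _ sM] _; exists M => x xM.
by split=> [|k]; [apply: support3_off|apply: partial3_off] => /sM.
Qed.

Lemma test_mul_integrable (v psi : R3 -> R) M : continuous v -> continuous psi ->
  (forall x, ~ cube M x -> psi x = 0) ->
  (lebesgue3 R).-integrable setT (EFin \o (fun x => v x * psi x)).
Proof.
move=> cv cpsi psi0; apply: (@continuous_cube_integrable _ _ M).
  by move=> x; apply: cvgM; [exact: cv|exact: cpsi].
by move=> x /psi0 ->; rewrite mulr0.
Qed.

(** The product rule makes the sum of the two integrands a derivative in the direction
   [e_k] of a function of compact support, so that its integral over each line parallel to
   [e_k] vanishes. *)
Lemma integration_by_parts3 k (v dv : R3 -> R) : continuous v -> continuous dv ->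
  (forall x, is_derive x (basis3 R k) v (dv x)) ->
  \int[lebesgue3 R]_(x in setT) (v x * partial3 k phi x) =
  - \int[lebesgue3 R]_(x in setT) (dv x * phi x).
Proof.
move=> cv cdv vdv; have [M phiM] := test_cube.
apply/eqP; rewrite -addr_eq0; apply/eqP.
have i1 := test_mul_integrable cv (test_partial_continuous (k := k))
  (fun x xM => (phiM x xM).2 k).
have i2 := test_mul_integrable cdv test_continuous (fun x xM => (phiM x xM).1).
rewrite -RintegralD// /Rintegral.
pose h x := v x * phi x.
pose dh x := v x * partial3 k phi x + dv x * phi x.
have hdh x : is_derive x (basis3 R k) h (dh x).
  have := vdv x; have := test_is_derive k x => d1 d2.
  have -> : dh x = v x *: partial3 k phi x + phi x *: dv x.
    by rewrite /dh /GRing.scale /= [phi x * _]mulrC.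
  exact: is_deriveM.
have cdh : continuous dh.
  move=> x; apply: cvgD; apply: cvgM; [exact: cv|exact: test_partial_continuous|
   exact: cdv|exact: test_continuous].
have dhM x : ~ cube M x -> dh x = 0.
  by move=> /phiM[p0 dp0]; rewrite /dh p0 dp0 !mulr0 addr0.
rewrite (integral_slices_eq0 cdh dhM (k := k))// => x.
have far s : M < `|s| -> ~ cube M (upd3 k x s).
  move=> Ms /(coord_cube k); rewrite coord3_upd3 => /(lt_le_trans Ms).
  by rewrite ltxx.
apply: (@integral_derivative_eq0 _ (fun s => h (upd3 k x s)) _ M).
- by move=> s; apply: continuous_comp; [exact: continuous_upd3|exact: cdh].
- move=> s; have /is_derive_slice := hdh (upd3 k x s).
  by rewrite coord3_upd3; under eq_fun do rewrite upd3_upd3.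
- by move=> s /far/phiM[p0 _]; rewrite /h p0 mulr0.
- by move=> s /far/dhM.
Qed.

End fixed_test_function.

Definition embedC (v : 'I_3 -> R3 -> R) : R3 -> C3 :=
  fun x => \row_k ((v k x)%:C)%C.

Lemma enorm_embedC v x : enorm (embedC v x) = Num.sqrt (\sum_(k < 3) v k x ^+ 2).
Proof.
by rewrite /enorm; congr Num.sqrt; apply: eq_bigr => k _; rewrite mxE /= expr0n addr0.
Qed.

Lemma L2norm_le (D : set R3) (u : R3 -> C3) (g : R3 -> R) (B : R) :
  (forall x, 0 <= g x) -> (forall x, D x -> enorm (u x) ^+ 2 <= g x) ->
  (\int[lebesgue3 R]_x (g x)%:E <= B%:E)%E ->
  (L2norm D u <= (Num.sqrt B)%:E)%E.
Proof.
move=> g0 ug gB.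
have int0 : (0 <= \int[lebesgue3 R]_x (g x)%:E)%E.
  by apply: integral_ge0 => x _; rewrite lee_fin.
have B0 : 0 <= B by rewrite -lee_fin (le_trans int0).
rewrite /L2norm unlock /= -powR12_sqrt// -poweR_EFin.
apply: gt0_ler_poweR; rewrite ?in_itv/= ?leey ?andbT//.
  by apply: integral_ge0 => x _; exact: poweR_ge0.
apply: le_trans gB; apply: ge0_le_integralT => x; first exact: poweR_ge0.
rewrite patchE; case: ifPn => [|_].
  rewrite inE => /ug h; rewrite -[abse _]/((`|enorm (u x)|)%:E) poweR_EFin lee_fin.
  by rewrite powR_mulrn// real_normK ?num_real.
by rewrite abse0 poweR0r ?lee_fin// pnatr_eq0.
Qed.

Lemma sum3E (V : nmodType) (F : 'I_3 -> V) : \sum_(k < 3) F k = F 0 + F 1 + F 2.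
Proof.
rewrite !big_ord_recl big_ord0 addr0 addrA.
by congr (_ + F _ + F _); exact: val_inj.
Qed.

Lemma L2loc_embedC v : (forall k, continuous (v k)) -> L2loc setT (embedC v).
Proof.
move=> cv; split.
  move=> k; split.
    under eq_fun do rewrite mxE /=; exact: continuous_measurable3.
  by under eq_fun do rewrite mxE /=; exact: measurable_cst.
move=> K cK _; have [M M0 KM] := compact_sub_cube cK.
pose s x := v 0 x ^+ 2 + v 1 x ^+ 2 + v 2 x ^+ 2.
have cs : continuous s.
  by move=> x; apply: cvgD; [apply: cvgD|]; apply: (cvgM (cv _ x) (cv _ x)).
have [C sC] := continuous_bounded_cube M cs.
pose g x := `|C| * \1_(cube M) x.
have g0 x : 0 <= g x by rewrite mulr_ge0.
have cM := lebesgue_cube_lty M.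
apply: le_lt_trans (L2norm_le (g := g) (B := `|C| * fine (lebesgue3 R (cube M))) g0 _ _) _.
- move=> x /KM xM; rewrite enorm_embedC sqr_sqrtr; last first.
    by apply: sumr_ge0 => k _; exact: sqr_ge0.
  rewrite /g indicE mem_set// mulr1 sum3E (le_trans _ (ler_norm _))//.
  exact: le_trans (ler_norm _) (sC _ xM).
- rewrite /g; under eq_integral do rewrite EFinM.
  rewrite ge0_integralZl//; last first.
    by apply/measurable_EFinP/measurable_indic; exact: measurable_cube.
  rewrite integral_indic ?setIT//; last exact: measurable_cube.
  by rewrite EFinM fineK// ge0_fin_numE.
- exact: ltry.
Qed.

(** Each term of the curl is integrated by parts in the direction of its own derivative, so
   that one continuous partial derivative at a time suffices. *)
Lemma classical_curl (v c : 'I_3 -> R3 -> R) (D : 'I_3 -> 'I_3 -> R3 -> R) :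
  (forall k, continuous (v k)) -> (forall k, continuous (c k)) ->
  (forall j k, j != k -> continuous (D j k)) ->
  (forall j k x, j != k -> is_derive x (basis3 R j) (v k) (D j k x)) ->
  (forall k x, c k x = D (k + 1) (k + 2) x - D (k + 2) (k + 1) x) ->
  is_curl setT (embedC v) (embedC c).
Proof.
move=> cv cc cD vD cE; split; first exact: L2loc_embedC.
move=> phi test k; have [M phiM] := test_cube test.
have n12 : k + 1 != k + 2 by have [->|->|->] := I3_cases k.
have n21 : k + 2 != k + 1 by rewrite eq_sym.
rewrite /cintegral.
under eq_Rintegral do rewrite !mxE /= !mul0r subr0.
under [X in (_ +i* X)%C = _]eq_Rintegral do rewrite !mxE /= mul0r mulr0 addr0.
under [X in _ = - (X +i* _)%C]eq_Rintegral do rewrite !mxE /= !mul0r !subr0.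
under [X in _ = - (_ +i* X)%C]eq_Rintegral do rewrite !mxE /= !mul0r !mulr0 !addr0 subr0.
have ii j l : (lebesgue3 R).-integrable setT (EFin \o (fun x => v l x * partial3 j phi x)).
  apply: (@test_mul_integrable _ _ M); [exact: cv|exact: test_partial_continuous|].
  by move=> x /phiM[_].
rewrite RintegralB; [|by []|exact: ii|exact: ii].
have i1 := test_mul_integrable (cD _ _ n12) (test_continuous test)
    (fun x xM => (phiM x xM).1).
have i2 := test_mul_integrable (cD _ _ n21) (test_continuous test)
    (fun x xM => (phiM x xM).1).
have p1 := integration_by_parts3 test (cv (k + 2)) (cD _ _ n12)
  (fun x => vD _ _ x n12).
have p2 := integration_by_parts3 test (cv (k + 1)) (cD _ _ n21)
  (fun x => vD _ _ x n21).
under eq_Rintegral do rewrite cE mulrBl.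
rewrite RintegralB// p1 p2.
have -> : \int[lebesgue3 R]_(_ in setT) 0 = 0 :> R by rewrite /Rintegral integral0.
by rewrite -[RHS]/(_ +i* _)%C oppr0 opprB opprK addrC.
Qed.

Lemma is_curl_subset (Omega : set R3) (u w : R3 -> C3) :
  is_curl setT u w -> is_curl Omega u w.
Proof.
move=> [[mw L2w] uw]; split.
  split=> [k|K cK _]; last exact: L2w.
  by have [? ?] := mw k; split; exact: measurable_funTS.
move=> phi test k.
have testT : test_function setT phi by case: test.
have off (f : R3 -> R[i]) : (forall x, ~ support3 phi x -> f x = 0) ->
    cintegral Omega f = cintegral setT f.
  move=> f0; rewrite /cintegral; congr (_ +i* _)%C.
    rewrite Rintegral_mkcond; apply: eq_Rintegral => x _.
    rewrite patchE; case: ifPn => // /negP xO; rewrite f0// => sx; apply: xO.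
    by rewrite inE; case: test => _ _; exact.
  rewrite Rintegral_mkcond; apply: eq_Rintegral => x _.
  rewrite patchE; case: ifPn => // /negP xO; rewrite f0// => sx; apply: xO.
  by rewrite inE; case: test => _ _; exact.
rewrite !off; first exact: uw.
  by move=> x sx; rewrite !partial3_off// !mulr0 subr0.
by move=> x sx; rewrite support3_off// mulr0.
Qed.

End weak_derivatives.

(** * The periodic field of a line current *)
Section plane_field.
Context {R : realType}.
Implicit Types w p q : R.

(** Its logarithm is, up to a constant factor, the Green function of the cylinder obtained
   by identifying [p] with [p + 2 pi]; up to truncation and an additive constant, the field
   below is its rotated gradient. *)
Definition potential p q := cosh q - cos p.
Definition capped_potential w p q := Num.max (potential p q) w.
Definition psi2 w p q := 1 / 2 + 1 / 2 * (capinv w (potential p q) * sinh q).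
Definition psi3 w p q := - (1 / 2) * (capinv w (potential p q) * sin p).
Definition dpsi2 w p q :=
  1 / 2 * (- (capped_potential w p q) ^- 2 * sinh q * sinh q + capinv w (potential p q) * cosh q).
Definition dpsi3 w p q :=
  - (1 / 2) * (- (capped_potential w p q) ^- 2 * sin p * sin p + capinv w (potential p q) * cos p).

Lemma potential_ge0 p q : 0 <= potential p q.
Proof. by have := cosh_ge1 q; have := cos_le1 p; rewrite /potential; lra. Qed.

Lemma is_derive_psi2 w p q : 0 < w -> is_derive q 1 (psi2 w p) (dpsi2 w p q).
Proof.
move=> w0.
have h1 : is_derive q 1 (potential p) (sinh q).
  by rewrite /potential; apply: is_derive_eq; rewrite subr0.
have h2 : is_derive q 1 (capinv w \o potential p) (- (capped_potential w p q) ^- 2 * sinh q).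
  by apply: is_derive1_comp; exact: is_derive_capinv.
have -> : psi2 w p = cst (1 / 2) + (1 / 2) *: ((capinv w \o potential p) * sinh).
  by apply/funext.
have h3 := is_deriveZ (1 / 2 : R) (is_deriveM h2 (is_derive_sinh q)).
have h4 := is_deriveD (is_derive_cst (1 / 2 : R) q (1 : R)) h3.
apply: (is_derive_eq h4).
rewrite /dpsi2 /GRing.scale /=; ring.
Qed.

Lemma is_derive_psi3 w p q : 0 < w ->
  is_derive p 1 (fun t => psi3 w t q) (dpsi3 w p q).
Proof.
move=> w0.
have h1 : is_derive p 1 (potential ^~ q) (sin p).
  by rewrite /potential; apply: is_derive_eq; rewrite add0r mul1r opprK.
have h2 : is_derive p 1 (capinv w \o potential ^~ q) (- (capped_potential w p q) ^- 2 * sin p).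
  by apply: is_derive1_comp; exact: is_derive_capinv.
have -> : (fun t => psi3 w t q) =
    (- (1 / 2)) *: ((capinv w \o potential ^~ q) * sin).
  by apply/funext.
apply: is_derive_eq; rewrite /dpsi3 /GRing.scale /=; ring.
Qed.

(** Since sin^2 + sinh^2 = (cosh - cos) (cosh + cos), the product rule leaves
   -(cos p + cosh q) / 2 times the derivative of [t * capinv w t] at the potential, and that
   function of [t] is constant above [w]. *)
Lemma psi_curl w p q : 0 < w ->
  dpsi3 w p q - dpsi2 w p q =
  - ((cos p + cosh q) * (capped_potential w p q - potential p q) / (capped_potential w p q) ^+ 2).
Proof.
move=> w0; rewrite /dpsi3 /dpsi2 /capinv -/(capped_potential w p q).
have M0 : capped_potential w p q != 0 by rewrite gt_eqF// lt_max w0 orbT.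
have := cosh2Bsinh2 q; have := sin2cos2 p.
set M := capped_potential w p q in M0 *; rewrite /potential => sc chs.
have e1 : sin p * sin p = 1 - cos p ^+ 2 by rewrite -sc expr2.
have e2 : sinh q * sinh q = cosh q ^+ 2 - 1 by rewrite -expr2; lra.
rewrite -(mulrA _ (sin p)) -(mulrA _ (sinh q)) e1 e2.
by field.
Qed.

(** Expanding the squares, with K the value of [capinv] and M the maximum of W and w, the
   left side is (K^2 W (cosh q + cos p) - 2 K |sinh q| + 1) / 4.  The bounds K W <= 1 <= K M
   bound it by K times (cosh q + cos p - 2 |sinh q| + M) / 4, where M <= W + w and
   cosh q - |sinh q| <= 1. *)
Lemma psi_error w p q : 0 < w -> w <= 1 ->
  (psi2 w p q - (0 < q)%R%:R) ^+ 2 + psi3 w p q ^+ 2 <= capinv w (potential p q).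
Proof.
move=> w0 w1; have W0 := potential_ge0 p q.
have k0 := capinv_ge0 w W0; have k1 := capinvM_le1 (potential p q) w0.
have k2 := capinv_max_ge1 (potential p q) w0.
rewrite /psi2 /psi3; set K := capinv _ _ in k0 k1 k2 *.
have M1 : Num.max (potential p q) w <= potential p q + w.
  by rewrite ge_max lerDl lerDr W0 ltW.
have k3 : 1 <= K * (potential p q + w).
  by apply: le_trans k2 _; rewrite ler_wpM2l.
have chs := cosh2Bsinh2 q; have sc := cos2Dsin2 p.
have c1 := cos_geN1 p; have c2 := cos_le1 p; have ch := cosh_ge1 q.
pose s := `|sinh q|.
have s2 : sinh q ^+ 2 = s ^+ 2 by rewrite real_normK ?num_real.
have chs1 : cosh q - s <= 1.
  rewrite /s; have [q0|/ltW q0] := leP 0 q.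
    rewrite ger0_norm ?sinh_ge0// coshBsinh -[leRHS]expR0 ler_expR; lra.
  rewrite ler0_norm; last by rewrite -oppr_ge0 -sinhN sinh_ge0//; lra.
  by rewrite -coshN -sinhN coshBsinh opprK -[leRHS]expR0 ler_expR.
have -> : (1 / 2 + 1 / 2 * (K * sinh q) - (0 < q)%R%:R) ^+ 2 = (1 / 2 - 1 / 2 * (K * s)) ^+ 2.
  rewrite /s; case: ltP => q0 /=.
    by rewrite ger0_norm ?sinh_ge0 ?ltW//; field.
  rewrite ler0_norm; last by rewrite -oppr_ge0 -sinhN sinh_ge0//; lra.
  by field.
have -> : (1 / 2 - 1 / 2 * (K * s)) ^+ 2 + (- (1 / 2) * (K * sin p)) ^+ 2 =
  1 / 4 * ((K * (s ^+ 2 + sin p ^+ 2)) * K - 2 * K * s + 1) by field.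
have -> : s ^+ 2 + sin p ^+ 2 = potential p q * (cosh q + cos p).
  rewrite /potential; nra.
have h : K * (potential p q * (cosh q + cos p)) <= cosh q + cos p.
  by rewrite mulrA; nra.
have h2 : K * (potential p q * (cosh q + cos p)) * K <= (cosh q + cos p) * K by rewrite ler_wpM2r.
suff : (cosh q + cos p) * K - 2 * K * s + K * (potential p q + w) <= 4 * K by lra.
rewrite /potential.
have : K * (2 * (cosh q - s) + w) <= K * 4 by rewrite ler_wpM2l//; lra.
nra.
Qed.

(** The restriction on [d] makes the origin the nearest zero of the potential. *)
Lemma potential_lower d y : `|d| <= 1 / 2 ->
  (d ^+ 2 + y ^+ 2) / 2 <= potential (2 * pi * d) (2 * pi * y).
Proof.
move=> d2; rewrite /potential; have := onem_cos_lower d2.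
have := cosh_lower (2 * pi * y); have := @pi_ge2 R; set P := @pi R => P2 h1 h2.
have : 4 * y ^+ 2 <= P ^+ 2 * y ^+ 2 by rewrite ler_wpM2r ?sqr_ge0//; nra.
have : 0 <= d ^+ 2 by exact: sqr_ge0.
have : 0 <= y ^+ 2 by exact: sqr_ge0.
have : (2 * P * y) ^+ 2 = 4 * (P ^+ 2 * y ^+ 2) by ring.
lra.
Qed.

End plane_field.

(** * The field in space and its curl *)
Section field_continuity.
Context {R : realType} (T : topologicalType) (P Q : T -> R) (w : R).
Hypotheses (cP : continuous P) (cQ : continuous Q) (w0 : 0 < w).

Lemma is_derive_continuous (f df : R -> R) :
  (forall x : R, is_derive x 1 f (df x)) -> continuous f.
Proof.
move=> fdf x; apply: differentiable_continuous; apply/derivable1_diffP.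
exact: ex_derive.
Qed.

Lemma continuous_app (f : R -> R) (g : T -> R) :
  continuous f -> continuous g -> continuous (fun x => f (g x)).
Proof. by move=> cf cg x; apply: continuous_comp; [exact: cg|exact: cf]. Qed.

Lemma continuous_addf (f g : T -> R) :
  continuous f -> continuous g -> continuous (fun x => f x + g x).
Proof. by move=> cf cg x; apply: cvgD; [exact: cf|exact: cg]. Qed.

Lemma continuous_mulf (f g : T -> R) :
  continuous f -> continuous g -> continuous (fun x => f x * g x).
Proof. by move=> cf cg x; apply: cvgM; [exact: cf|exact: cg]. Qed.

Lemma continuous_oppf (f : T -> R) : continuous f -> continuous (fun x => - f x).
Proof. by move=> cf x; apply: cvgN; exact: cf. Qed.

Let ccst (c : R) : continuous (fun _ : T => c).
Proof. by move=> x; exact: cvg_cst. Qed.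

Let ccosh : continuous (fun x => cosh (Q x)).
Proof. by apply: continuous_app => //; exact: is_derive_continuous. Qed.
Let csinh : continuous (fun x => sinh (Q x)).
Proof. by apply: continuous_app => //; exact: is_derive_continuous. Qed.
Let ccos : continuous (fun x => cos (P x)).
Proof. by apply: continuous_app => //; exact: continuous_cos. Qed.
Let csin : continuous (fun x => sin (P x)).
Proof. by apply: continuous_app => //; exact: continuous_sin. Qed.

Lemma continuous_potential : continuous (fun x => potential (P x) (Q x)).
Proof. by apply: continuous_addf => //; exact: continuous_oppf. Qed.

Let ccap : continuous (fun x => capinv w (potential (P x) (Q x))).
Proof.
apply: continuous_app; last exact: continuous_potential.
by apply: is_derive_continuous => t; exact: is_derive_capinv.
Qed.

Let crad : continuous (fun x => - capped_potential w (P x) (Q x) ^- 2).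
Proof.
apply: continuous_oppf; apply: (@continuous_app (fun t => (Num.max t w ^+ 2)^-1)).
  move=> t; apply: cvgV.
    by rewrite expf_neq0// gt_eqF// lt_max w0 orbT.
  by apply: cvgM; exact: continuous_max_cst.
exact: continuous_potential.
Qed.

Lemma continuous_psi2 : continuous (fun x => psi2 w (P x) (Q x)).
Proof.
do ![exact: ccst|exact: csinh|exact: ccosh|exact: ccos|exact: csin|exact: ccap|
  exact: crad|apply: continuous_addf|apply: continuous_mulf].
Qed.

Lemma continuous_psi3 : continuous (fun x => psi3 w (P x) (Q x)).
Proof.
do ![exact: ccst|exact: csinh|exact: ccosh|exact: ccos|exact: csin|exact: ccap|
  exact: crad|apply: continuous_addf|apply: continuous_mulf].
Qed.

Lemma continuous_dpsi2 : continuous (fun x => dpsi2 w (P x) (Q x)).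
Proof.
do ![exact: ccst|exact: csinh|exact: ccosh|exact: ccos|exact: csin|exact: ccap|
  exact: crad|apply: continuous_addf|apply: continuous_mulf].
Qed.

Lemma continuous_dpsi3 : continuous (fun x => dpsi3 w (P x) (Q x)).
Proof.
do ![exact: ccst|exact: csinh|exact: ccosh|exact: ccos|exact: csin|exact: ccap|
  exact: crad|apply: continuous_addf|apply: continuous_mulf].
Qed.

End field_continuity.

Section space_field.
Context {R : realType}.
Local Notation R3 := (R * R * R)%type.
Variables (z : R * R) (w : R).
Hypothesis w0 : 0 < w.
Implicit Types (x : R3) (j k : 'I_3).

(** One period of the angular variables corresponds to a unit of length. *)
Definition angle2 x := 2 * pi * (x.1.2 - z.1).
Definition angle3 x := 2 * pi * (x.2 - z.2).

Definition psi k x : R :=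
  if k == 1 then psi2 w (angle2 x) (angle3 x) else
  if k == 2 then psi3 w (angle2 x) (angle3 x) else 0.

(** The Jacobian matrix of [psi] off its diagonal. *)
Definition dpsi j k x : R :=
  if (j == 1) && (k == 2) then 2 * pi * dpsi3 w (angle2 x) (angle3 x) else
  if (j == 2) && (k == 1) then 2 * pi * dpsi2 w (angle2 x) (angle3 x) else 0.

Definition curl_psi k x : R :=
  if k == 0 then 2 * pi * (dpsi3 w (angle2 x) (angle3 x) - dpsi2 w (angle2 x) (angle3 x))
  else 0.

Lemma continuous_angle2 : continuous angle2.
Proof.
move=> x; apply: cvgM; first exact: cvg_cst.
apply: cvgB; last exact: cvg_cst.
exact: (cvg_comp _ _ (@cvg_fst _ _ _ _ _) (@cvg_snd _ _ _ _ _)).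
Qed.

Lemma continuous_angle3 : continuous angle3.
Proof.
move=> x; apply: cvgM; first exact: cvg_cst.
by apply: cvgB; [exact: cvg_snd|exact: cvg_cst].
Qed.

Let cst_cont (c : R) : continuous (fun _ : R3 => c).
Proof. by move=> x; exact: cvg_cst. Qed.

Let c2 := continuous_angle2.
Let c3 := continuous_angle3.

Lemma continuous_psi k : continuous (psi k).
Proof.
have [->|->|->] := I3_cases k; rewrite /psi /=.
- exact: cst_cont.
- exact: continuous_psi2.
- exact: continuous_psi3.
Qed.

Lemma continuous_dpsi j k : continuous (dpsi j k).
Proof.
rewrite /dpsi; case: ((j == 1) && (k == 2)); last case: ((j == 2) && (k == 1)).
- by apply: continuous_mulf; [exact: cst_cont|exact: continuous_dpsi3].
- by apply: continuous_mulf; [exact: cst_cont|exact: continuous_dpsi2].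
- exact: cst_cont.
Qed.

Lemma continuous_curl_psi k : continuous (curl_psi k).
Proof.
rewrite /curl_psi; case: (k == 0); last exact: cst_cont.
apply: continuous_mulf; first exact: cst_cont.
apply: continuous_addf; first exact: continuous_dpsi3.
by apply: continuous_oppf; exact: continuous_dpsi2.
Qed.

Lemma is_derive_scaled (f df : R -> R) (c s : R) : (forall t : R, is_derive t 1 f (df t)) ->
  is_derive s 1 (fun t => f (2 * pi * (t - c))) (2 * pi * df (2 * pi * (s - c))).
Proof.
move=> fdf; have h : is_derive s 1 (fun t : R => 2 * pi * (t - c)) (2 * pi).
  by apply: is_derive_eq; rewrite /GRing.scale /=; ring.
by rewrite [2 * pi * df _]mulrC; exact: (is_derive1_comp (fdf _) h).
Qed.

Lemma is_derive_psi j k x : j != k -> is_derive x (basis3 R j) (psi k) (dpsi j k x).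
Proof.
move=> jk; apply/is_derive_slice.
have [ek|ek|ek] := I3_cases k; have [ej|ej|ej] := I3_cases j; subst k j;
  try (by rewrite eqxx in jk); rewrite /psi /dpsi /coord3 /upd3 /angle2 /angle3 /=.
- exact: is_derive_cst.
- exact: is_derive_cst.
- exact: is_derive_cst.
- exact: (is_derive_scaled _ _ (fun t => is_derive_psi2 (2 * pi * (x.1.2 - z.1)) t w0)).
- exact: is_derive_cst.
- exact: (is_derive_scaled _ _ (fun t => is_derive_psi3 t (2 * pi * (x.2 - z.2)) w0)).
Qed.

Lemma curl_psiE k x : curl_psi k x = dpsi (k + 1) (k + 2) x - dpsi (k + 2) (k + 1) x.
Proof.
by have [->|->|->] := I3_cases k; rewrite /curl_psi /dpsi /= ?subrr// mulrBr.
Qed.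

Lemma is_curl_psi : is_curl setT (embedC psi) (embedC curl_psi).
Proof.
apply: (@classical_curl _ _ _ dpsi).
- exact: continuous_psi.
- exact: continuous_curl_psi.
- by move=> j k _; exact: continuous_dpsi.
- by move=> j k x; exact: is_derive_psi.
- exact: curl_psiE.
Qed.

Lemma psi_Hdot_per_curl : Hdot_per_curl (embedC psi).
Proof.
exists (embedC psi); split => //.
- split; first exact: L2loc_embedC continuous_psi.
  by exists (embedC curl_psi); exact: is_curl_psi.
- apply: aeW => x; apply/rowP => k; rewrite !mxE; congr (_%:C)%C.
  by rewrite /psi /angle2 /angle3 /basis3 /= !addr0.
- apply: aeW => x; apply/rowP => k; rewrite !mxE; congr (_%:C)%C.
  have e : angle2 (x + basis3 R 1) = angle2 x + pi *+ 2.
    by rewrite /angle2 /basis3 /=; ring.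
  have e3 : angle3 (x + basis3 R 1) = angle3 x.
    by rewrite /angle3 /basis3 /= addr0.
  by rewrite /psi /psi2 /psi3 /potential e e3 sinD2pi cosD2pi.
Qed.

End space_field.

(** * Two integrals on the line *)
Section line_integrals.
Context {R : realType}.
Local Notation lam := (@lebesgue_measure R).
Implicit Types (b c r s t : R).

Lemma sqrD_gt0 b s : 0 < b -> 0 < s ^+ 2 + b ^+ 2.
Proof. by move=> b0; have := sqr_ge0 s; have := exprn_gt0 2 b0; lra. Qed.

Lemma continuous_lorentz b c : 0 < b -> continuous (fun s => ((s - c) ^+ 2 + b ^+ 2)^-1).
Proof.
move=> b0 s; apply: cvgV; first by rewrite gt_eqF// sqrD_gt0.
apply: cvgD; last exact: cvg_cst.
have h : (fun t => t - c) @ s --> s - c by apply: cvgB; [exact: cvg_id|exact: cvg_cst].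
exact: (cvgM h h).
Qed.

Lemma is_derive_lorentz b c s : 0 < b ->
  is_derive s 1 (fun t => b^-1 * atan ((t - c) / b)) (((s - c) ^+ 2 + b ^+ 2)^-1).
Proof.
move=> b0.
have h1 : is_derive s 1 (fun t => (t - c) / b) b^-1.
  have h := is_deriveZ b^-1 (is_deriveB (is_derive_id s (1 : R)) (is_derive_cst c s 1)).
  have -> : (fun t => (t - c) / b) = b^-1 *: (id - cst c).
    by apply/funext => t; rewrite mulrC.
  by apply: (is_derive_eq h); rewrite subr0 /GRing.scale /= mulr1.
have h2 := is_deriveZ b^-1
  (@is_derive1_comp _ atan (fun t => (t - c) / b) s _ _ (is_derive1_atan _) h1).
apply: (is_derive_eq h2); rewrite /GRing.scale /=.
have := sqrD_gt0 (s - c) b0; have := sqrD_gt0 ((s - c) / b) (@ltr01 R).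
by rewrite expr1n => h3 h4; field; rewrite !gt_eqF//=; lra.
Qed.

(** The integrand is at most b^-2, which governs large b, and its antiderivative
   atan ((s - c) / b) / b varies by at most pi / b, which governs small b. *)
Lemma lorentz_integral b c : 0 < b ->
  (\int[lam]_(s in `[0%R, 1%R]) (((s - c) ^+ 2 + b ^+ 2)^-1)%:E
     <= (5 / (b * (b + 1)))%:E)%E.
Proof.
move=> b0.
pose f s := ((s - c) ^+ 2 + b ^+ 2)^-1.
pose F t := b^-1 * atan ((t - c) / b).
have cF : continuous F by apply: is_derive_continuous => s; exact: is_derive_lorentz.
have fF : (\int[lam]_(s in `[0%R, 1%R]) (f s)%:E = (F 1 - F 0)%:E)%E.
  rewrite (@continuous_FTC2 _ f F)//.
  - by apply: continuous_subspaceT; exact: continuous_lorentz.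
  - split; last 2 first.
    + exact/cvg_at_right_filter/cF.
    + exact/cvg_at_left_filter/cF.
    by move=> s _; case: (is_derive_lorentz c s b0).
  - by move=> s _; rewrite derive1E; case: (is_derive_lorentz c s b0).
have f1 : (\int[lam]_(s in `[0%R, 1%R]) (f s)%:E <= (b ^- 2)%:E)%E.
  apply: (@le_trans _ _ (\int[lam]_(s in `[0%R, 1%R]) (cst (b ^- 2)%:E s))%E).
    apply: ge0_le_integral => //.
    - by move=> s _; rewrite lee_fin invr_ge0 ltW// sqrD_gt0.
    - apply/measurable_EFinP; apply: measurable_funTS.
      by apply: continuous_measurable_fun; exact: continuous_lorentz.
    - move=> s _; rewrite /= lee_fin /f lef_pV2 ?posrE ?sqrD_gt0 ?exprn_gt0//.
      by rewrite lerDr sqr_ge0.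
  by rewrite integral_cst//= lebesgue_measure_itv/= lte_fin ltr01 -EFinB subr0 mule1.
have f2 : F 1 - F 0 <= 4 / b.
  have := atan_ltpi2 ((1 - c) / b); have := atan_gtNpi2 ((0 - c) / b).
  have := @pihalf_lt2 R; move=> ? ? ?.
  by rewrite /F -mulrBr mulrC ler_wpM2r ?invr_ge0 ?(ltW b0)//; lra.
move: f1; rewrite fF !lee_fin => f1.
set D := F 1 - F 0 in f1 f2 *.
rewrite ler_pdivlMr; last by rewrite mulr_gt0//; lra.
have : D * b <= 4 by rewrite -ler_pdivlMr.
have : D * b ^+ 2 <= 1 by rewrite -ler_pdivlMr ?exprn_gt0// div1r.
lra.
Qed.

(** What [lorentz_integral] leaves, up to a factor, after integration in x_2 at height [t]:
   integrable at infinity, with an integral that diverges like ln (1 / r) as r tends to 0. *)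
Definition decay r t := ((`|t| + r) * (`|t| + r + 1))^-1.

Lemma decay_ge0 r t : 0 < r -> 0 <= decay r t.
Proof. by move=> r0; rewrite invr_ge0 mulr_ge0// ?addr_ge0// ltW. Qed.

Lemma continuous_decay r : 0 < r -> continuous (decay r).
Proof.
move=> r0 t.
have n0 := normr_ge0 t.
have nr : (fun t => `|t| + r) @ t --> `|t| + r.
  by apply: cvgD; [exact: norm_continuous|exact: cvg_cst].
apply: cvgV; first by rewrite gt_eqF// mulr_gt0//; lra.
by apply: cvgM => //; apply: cvgD => //; exact: cvg_cst.
Qed.

(** On the half-line the antiderivative is ln (t + r) - ln (t + r + 1). *)
Lemma decay_integral0 r : 0 < r ->
  (\int[lam]_t (decay r t)%:E = (2 * (ln (r + 1) - ln r))%:E)%E.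
Proof.
move=> r0; rewrite ge0_symfun_integralT.
- pose F t := ln (t + r) - ln (t + r + 1).
  have dF t : 0 <= t -> is_derive t 1 F (decay r t).
    move=> t0.
    have h1 : is_derive t 1 (fun t => t + r) 1.
      by apply: is_derive_eq; rewrite addr0.
    have h2 : is_derive t 1 (fun t => t + r + 1) 1.
      by apply: is_derive_eq; rewrite !addr0.
    have l1 : is_derive (t + r) 1 (@ln R) (t + r)^-1 by apply: is_derive1_ln; lra.
    have l2 : is_derive (t + r + 1) 1 (@ln R) (t + r + 1)^-1 by apply: is_derive1_ln; lra.
    have h := is_deriveB (@is_derive1_comp _ _ (fun t => t + r) _ _ _ l1 h1)
      (@is_derive1_comp _ _ (fun t => t + r + 1) _ _ _ l2 h2).
    apply: (is_derive_eq h); rewrite /decay ger0_norm//.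
    by field; rewrite !gt_eqF//; lra.
  have -> : [set x : R | 0 <= x] = `[0, +oo[%classic.
    by apply/seteqP; split => x /=; rewrite in_itv/= andbT.
  rewrite (@ge0_continuous_FTC2y _ (decay r) F 0 0).
  + by rewrite -EFinB -EFinM /F !add0r opprB.
  + by move=> t _; exact: decay_ge0.
  + by apply: continuous_subspaceT; exact: continuous_decay.
  + apply/cvgrPdist_le => e e0; near=> t.
    have te : e^-1 <= t by near: t; apply: nbhs_pinfty_ge; rewrite num_real.
    have t0 : 0 < t by apply: lt_le_trans te; rewrite invr_gt0.
    have tr : 0 < t + r by lra.
    have -> : 0 - F t = ln (1 + (t + r)^-1).
      rewrite sub0r opprB -ln_div ?posrE//; last by lra.
      by congr ln; field; rewrite gt_eqF.
    have i0 : 0 < (t + r)^-1 by rewrite invr_gt0.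
    rewrite ger0_norm; last by rewrite ln_ge0//; lra.
    apply: le_trans (le_ln1Dx _) _; first by lra.
    rewrite -[e]invrK lef_pV2 ?posrE ?invr_gt0//; lra.
  + by move=> t t0; case: (dF t (ltW t0)).
  + have := dF 0 (lexx _) => d0; apply: cvg_at_right_filter.
    by apply: differentiable_continuous; apply/derivable1_diffP; case: d0.
  + move=> t; rewrite in_itv/= andbT => t0.
    by rewrite derive1E; case: (dF t (ltW t0)).
- by move=> t; exact: decay_ge0.
- exact: continuous_decay.
- by move=> t; rewrite /decay /= normrN.
Unshelve. all: by end_near. Qed.

Lemma decay_integral r c : 0 < r ->
  (\int[lam]_t (decay r (t - c))%:E = (2 * (ln (r + 1) - ln r))%:E)%E.
Proof.
move=> r0; rewrite -(decay_integral0 r0).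
have d1 t : is_derive t 1 (fun t : R => t - c) 1.
  by apply: is_derive_eq; rewrite subr0.
have D1 : (fun t : R => t - c)^`()%classic = cst 1.
  by apply/funext => t; rewrite derive1E; case: (d1 t).
rewrite (@increasing_ge0_integration_by_substitutionT _ (fun t => t - c) (decay r)).
- by apply: eq_integral => t _; rewrite D1 fctE /= mulr1.
- by move=> x y; rewrite ltrD2r.
- by rewrite D1; exact: cst_continuous.
- by rewrite D1; exact: is_cvg_cst.
- by rewrite D1; exact: is_cvg_cst.
- by move=> t; case: (d1 t).
- exact: (cvg_addrr_Ny (- c)).
- exact: (cvg_addrr (- c)).
- exact: continuous_decay.
- by move=> t; exact: decay_ge0.
Qed.
End line_integrals.

(** * Energy estimates *)
Section cell_integral.
Context {R : realType}.
Local Notation R3 := (R * R * R)%type.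
Local Notation measR3 :=
  (measurableTypeR R * measurableTypeR R * measurableTypeR R)%type.
Local Notation lam := (@lebesgue_measure R).

Definition unit_segm : set R := `[0, 1]%classic.
Definition unit_cell : set R3 := (unit_segm `*` unit_segm) `*` setT.

Lemma measurable_unit_segm : measurable unit_segm.
Proof. exact: measurable_itv. Qed.

Lemma lebesgue_unit_segm : lam unit_segm = 1%E.
Proof. by rewrite /unit_segm lebesgue_measure_itv/= lte_fin ltr01 -EFinB subr0. Qed.

Lemma measurable_unit_cell : measurable (unit_cell : set measR3).
Proof.
apply: measurableX => //.
by apply: measurableX; exact: measurable_unit_segm.
Qed.

Lemma indic_unit_cell (s t u : R) :
  \1_unit_cell ((s, t), u) = \1_unit_segm s * \1_unit_segm t :> R.
Proof.
rewrite !indicE.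
have [hs|hs] := pselect (unit_segm s); have [ht|ht] := pselect (unit_segm t).
- by rewrite !mem_set// mulr1.
- by rewrite (memNset ht) mulr0 memNset// => -[[]].
- by rewrite (memNset hs) mul0r memNset// => -[[]].
- by rewrite (memNset hs) mul0r memNset// => -[[]].
Qed.

(** Tonelli's theorem: integrate in x_1, then in x_2, then in x_3. *)
Lemma cell_integral_le (G : R -> R -> R) (h : R -> R) :
  continuous (fun x : R3 => G x.1.2 x.2) -> (forall s t, 0 <= G s t) ->
  (forall t, (\int[lam]_(s in `[0%R, 1%R]) (G s t)%:E <= (h t)%:E)%E) ->
  (\int[lebesgue3 R]_x (\1_unit_cell x * G x.1.2 x.2)%:E <= \int[lam]_t (h t)%:E)%E.
Proof.
move=> cG G0 Gh.
pose g (x : R3) : R := \1_unit_cell x * G x.1.2 x.2.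
have mg : measurable_fun setT (g : measR3 -> R).
  apply: measurable_funM; last exact: continuous_measurable3.
  by apply: measurable_indic; exact: measurable_unit_cell.
have g0 x : 0 <= g x by rewrite mulr_ge0.
have -> : (\int[lebesgue3 R]_x (g x)%:E = \int[lam]_t \int[lebesgue2]_a (g (a, t))%:E)%E.
  apply: (@fubini_tonelli2 _ _ _ _ R (@lebesgue2 R) lam (EFin \o g)).
    exact/measurable_EFinP.
  by move=> x; rewrite lee_fin.
apply: ge0_le_integralT => t.
  by apply: integral_ge0 => x _; rewrite lee_fin.
apply: le_trans (Gh t).
have mgt : measurable_fun setT (fun a : (measurableTypeR R * measurableTypeR R)%type => g (a, t)).
  by apply: (measurableT_comp mg); exact: pair2_measurable.
have -> : (\int[lebesgue2]_a (g (a, t))%:E =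
           \int[lam]_s \int[lam]_x (g ((x, s), t))%:E)%E.
  apply: (@fubini_tonelli2 _ _ _ _ R lam lam (EFin \o (fun a => g (a, t)))).
    exact/measurable_EFinP.
  by move=> x; rewrite lee_fin.
rewrite [leRHS]integral_mkcond; apply: ge0_le_integralT => s.
  by apply: integral_ge0 => x _; rewrite lee_fin.
rewrite /g /=.
under eq_integral do rewrite indic_unit_cell -mulrA EFinM.
rewrite ge0_integralZr//; last 2 first.
- by apply/measurable_EFinP/measurable_indic; exact: measurable_unit_segm.
- by rewrite lee_fin mulr_ge0.
rewrite integral_indic//; last exact: measurable_unit_segm.
rewrite setIT [X in (X * _)%E]lebesgue_unit_segm mul1e patchE indicE /unit_segm.
by case: ifP => _; rewrite ?mul1r// mul0r.
Qed.

End cell_integral.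

Section field_bounds.
Context {R : realType}.
Local Notation R3 := (R * R * R)%type.
Local Notation lam := (@lebesgue_measure R).

Lemma potential_period (p q : R) (e : bool) :
  potential (p - (if e then 1 else -1) * (pi *+ 2)) q = potential p q.
Proof.
rewrite /potential; case: e.
  by rewrite mul1r -[in RHS](subrK (pi *+ 2) p) cosD2pi.
by rewrite mulN1r opprK cosD2pi.
Qed.

(** Points of the cell are at distance less than 1 from the axis of the wire in the x_2
   direction, so that the nearest zero of the potential is one of three. *)
Lemma nearest_integer (d : R) : -1 < d < 1 ->
  exists2 e, e \in [:: d - 1; d; d + 1] & `|e| <= 1 / 2 /\
    forall q, potential (2 * pi * d) q = potential (2 * pi * e) q.
Proof.
move=> /andP[d1 d2].
have [l1|l1] := ltP d (- (1 / 2)).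
  exists (d + 1); first by rewrite !inE eqxx !orbT.
  split=> [|q]; first by rewrite ler_norml; lra.
  rewrite -[LHS](potential_period _ _ false); congr potential.
  by ring.
have [l2|l2] := leP d (1 / 2).
  exists d; first by rewrite !inE eqxx !orbT.
  by split=> //; rewrite ler_norml; lra.
exists (d - 1); first by rewrite !inE eqxx.
split=> [|q]; first by rewrite ler_norml; lra.
rewrite -[LHS](potential_period _ _ true); congr potential.
by ring.
Qed.

Variables (z : R * R) (r : R).
Hypotheses (z1 : 0 < z.1 < 1).
Hypotheses (r0 : 0 < r) (rz : r <= z.1) (rz1 : r <= 1 - z.1).

(** By [potential_lower], a potential below this value forces the squared distance to the
   nearest of its zeros to be less than r^2. *)
Definition threshold := r ^+ 2 / 2.

Lemma threshold_gt0 : 0 < threshold.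
Proof. by rewrite divr_gt0// exprn_gt0. Qed.

Lemma threshold_le1 : threshold <= 1 / 2.
Proof.
move: r0 rz rz1 => *; rewrite /threshold ler_pdivrMr// -mulrA mul1r.
have : r ^+ 2 <= 1 by rewrite expr_le1//; lra.
lra.
Qed.

(** The zero of the potential nearest to a point of the cell is one of three; summing over
   all three avoids having to know which. *)
Definition lorentz_sum (s b : R) :=
  ((s - (z.1 - 1)) ^+ 2 + b ^+ 2)^-1 + ((s - z.1) ^+ 2 + b ^+ 2)^-1 +
  ((s - (z.1 + 1)) ^+ 2 + b ^+ 2)^-1.

Lemma capinv_cell_le (s t : R) : 0 < s < 1 ->
  capinv threshold (potential (2 * pi * (s - z.1)) (2 * pi * (t - z.2))) <=
  16 * lorentz_sum s (`|t - z.2| + r).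
Proof.
move: z1 r0 => /andP[? ?] r0' /andP[s0 s1].
set d := s - z.1; set y := t - z.2.
have [|e ein [e2 ->]] := @nearest_integer d; first by rewrite /d; lra.
set W := potential _ _; set b := `|y| + r.
have W0 : 0 <= W by exact: potential_ge0.
have b0 : 0 < b by rewrite ltr_wpDl.
apply: le_trans (capinv_le threshold_gt0 W0) _.
have WL : (e ^+ 2 + y ^+ 2) / 2 <= W by exact: potential_lower.
have WM : W <= Num.max W threshold by rewrite le_max lexx.
have cM : threshold <= Num.max W threshold by rewrite le_max lexx orbT.
have bb : b ^+ 2 <= 2 * (y ^+ 2 + r ^+ 2).
  have -> : y ^+ 2 = `|y| ^+ 2 by rewrite real_normK ?num_real.
  by rewrite /b; have := sqr_ge0 (`|y| - r); nra.
have M8 : (e ^+ 2 + b ^+ 2) / 8 <= Num.max W threshold.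
  have := sqr_ge0 e; rewrite /threshold in cM *; lra.
have eb : 0 < e ^+ 2 + b ^+ 2 by exact: sqrD_gt0.
(* One of the three terms of [lorentz_sum] is the inverse of [e ^+ 2 + b ^+ 2]. *)
have step : 2 / Num.max W threshold <= 16 * (e ^+ 2 + b ^+ 2)^-1.
  have -> : 16 * (e ^+ 2 + b ^+ 2)^-1 = 2 / ((e ^+ 2 + b ^+ 2) / 8).
    by field; rewrite gt_eqF.
  by rewrite ler_wpM2l// lef_pV2 ?posrE//; lra.
apply: le_trans step _; rewrite ler_wpM2l// /lorentz_sum.
have pos (u : R) : 0 <= (u ^+ 2 + b ^+ 2)^-1 by rewrite invr_ge0 ltW// sqrD_gt0.
have E1 : s - (z.1 - 1) = d + 1 by rewrite /d; ring.
have E2 : s - (z.1 + 1) = d - 1 by rewrite /d; ring.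
rewrite E1 E2 -/d.
have p1 := pos (d + 1); have p2 := pos d; have p3 := pos (d - 1).
move: ein; rewrite !inE => /orP[/eqP->|/orP[/eqP->|/eqP->]]; lra.
Qed.

(** The translates of the disc by one period do not meet the cell, because r is at most the
   distance of the axis to its lateral sides. *)
Lemma disc_of_potential (s t : R) : 0 < s < 1 ->
  potential (2 * pi * (s - z.1)) (2 * pi * (t - z.2)) < threshold -> disc r z (s, t).
Proof.
move: z1 r0 rz rz1 => /andP[? ?] r0' rz' rz1' /andP[s0 s1].
set d := s - z.1; set y := t - z.2.
have [|e ein [e2 ->]] := @nearest_integer d; first by rewrite /d; lra.
move=> W; have := le_lt_trans (potential_lower y e2) W; rewrite /threshold => er.
have {}er : e ^+ 2 + y ^+ 2 < r ^+ 2 by lra.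
rewrite /disc /= -/d -/y.
have y0 := sqr_ge0 y.
move: ein; rewrite !inE => /orP[/eqP ed|/orP[/eqP ed|/eqP ed]].
- have e1 : e ^+ 2 = (1 - d) ^+ 2 by rewrite ed; ring.
  have : r ^+ 2 <= e ^+ 2 by rewrite e1 ler_sqr ?nnegrE /d; lra.
  lra.
- by rewrite -ed.
- have : r ^+ 2 <= e ^+ 2 by rewrite ed ler_sqr ?nnegrE /d; lra.
  lra.
Qed.

End field_bounds.

Section energy_bounds.
Context {R : realType}.
Local Notation R3 := (R * R * R)%type.
Local Notation C3 := 'rV[R[i]]_3.
Local Notation measR3 :=
  (measurableTypeR R * measurableTypeR R * measurableTypeR R)%type.
Local Notation lam := (@lebesgue_measure R).

(** Otherwise the disc would contain a point on a lateral side of the unit square. *)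
Lemma disc_margin (z : R * R) (R0 : R) : 0 < R0 ->
  closure (disc R0 z) `<=` `]0, 1[ `*` `]0, 1[ -> R0 <= z.1 /\ R0 <= 1 - z.1.
Proof.
move=> R00 sub; split; rewrite leNgt; apply/negP => h.
  have [] : (`]0, 1[ `*` `]0, 1[)%classic ((0 : R), z.2).
    apply/sub/subset_closure; rewrite /disc /= subrr expr0n addr0.
    have [] : (`]0, 1[ `*` `]0, 1[)%classic z.
      by apply/sub/subset_closure; rewrite /disc /= !subrr expr0n addr0 exprn_gt0.
    rewrite /= !in_itv/= => /andP[? ?] _.
    by rewrite sub0r sqrrN ltr_sqr ?nnegrE; lra.
  by rewrite /= in_itv/= ltxx.
have [] : (`]0, 1[ `*` `]0, 1[)%classic ((1 : R), z.2).
  apply/sub/subset_closure; rewrite /disc /= subrr expr0n addr0.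
  have [] : (`]0, 1[ `*` `]0, 1[)%classic z.
    by apply/sub/subset_closure; rewrite /disc /= !subrr expr0n addr0 exprn_gt0.
  rewrite /= !in_itv/= => /andP[? ?] _.
  by rewrite ltr_sqr ?nnegrE; lra.
by rewrite /= in_itv/= ltxx andbF.
Qed.

Definition upper (k : 'I_3) (x : R3) : R := ((k == 1) && (0 < x.2))%:R.

Lemma upper_e2E (x : R3) : upper_e2 x = embedC upper x.
Proof.
apply/rowP => k; rewrite /upper_e2 /embedC mxE /upper; case: ifP => _; rewrite mxE.
  by rewrite andbT eqxx /=; case: (k == 1).
by rewrite andbF.
Qed.

Lemma embedCB (u v : 'I_3 -> R3 -> R) x :
  embedC u x - embedC v x = embedC (fun k x => u k x - v k x) x.
Proof. by apply/rowP => k; rewrite !mxE rmorphB. Qed.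

Variables (z : R * R) (r : R).
Hypotheses (z1 : 0 < z.1 < 1) (z2 : 0 < z.2 < 1).
Hypotheses (r0 : 0 < r) (rz : r <= z.1) (rz1 : r <= 1 - z.1).
Let w := threshold r.
Let w0 : 0 < w := threshold_gt0 r0.

Definition unit_cube : set R3 := (unit_segm `*` unit_segm) `*` unit_segm.

Definition error_bound (s t : R) := 32 * lorentz_sum z s (`|t - z.2| + r).

Lemma lorentz_ge0 (b s : R) : 0 < b -> 0 <= (s ^+ 2 + b ^+ 2)^-1.
Proof. by move=> b0; rewrite invr_ge0 ltW// sqrD_gt0. Qed.

Lemma shifted_abs_gt0 t : 0 < `|t - z.2| + r.
Proof. by rewrite ltr_wpDl. Qed.

Lemma error_bound_ge0 s t : 0 <= error_bound s t.
Proof.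
by rewrite mulr_ge0// !addr_ge0// lorentz_ge0// shifted_abs_gt0.
Qed.

(** Passing from 1_{x_3 > z_3} to 1_{x_3 > 0} changes the target by at most 1, and only where
   0 < x_3 < 1; hence the second term. *)
Lemma psi_error_le (x : R3) : cylZ x ->
  enorm (embedC (psi z w) x - upper_e2 x) ^+ 2 <=
  \1_unit_cell x * error_bound x.1.2 x.2 + 2 * \1_unit_cube x.
Proof.
case: x => [[x1 s] t] [/= /andP[a1 b1] /andP[s0 s1]].
rewrite upper_e2E embedCB enorm_embedC sqr_sqrtr; last first.
  by apply: sumr_ge0 => k _; exact: sqr_ge0.
rewrite sum3E /psi /upper /= subrr expr0n add0r subr0.
set p := angle2 _ _; set q := angle3 _ _.
have w1 : w <= 1 by have := threshold_le1 r0 rz rz1; rewrite /w; lra.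
have := psi_error p q w0 w1.
have := @capinv_cell_le _ z r z1 r0 s t.
rewrite s0 s1 => /(_ isT); rewrite -/p -/q -/w => cap err.
have x1u : unit_segm x1 by rewrite /unit_segm /= in_itv/= !ltW.
have su : unit_segm s by rewrite /unit_segm /= in_itv/= !ltW.
have -> : \1_unit_cell (x1, s, t) = 1 :> R by rewrite indicE mem_set//; split=> //; split.
rewrite mul1r.
have pi0 := @pi_gt0 R.
have qs : (0 < q) = (z.2 < t).
  by rewrite /q /angle3 /= pmulr_rgt0 ?subr_gt0// mulr_gt0.
rewrite qs in err.
have h : ((z.2 < t)%R%:R - (0 < t)%R%:R) ^+ 2 <= \1_unit_cube (x1, s, t) :> R.
  rewrite indicE; move: z2 => /andP[z20 z21].
  case: (ltP z.2 t) => tz; case: (ltP 0 t) => t0 /=.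
  - by rewrite subrr expr0n.
  - by lra.
  - rewrite mem_set ?sub0r ?sqrrN ?expr1n//.
    by split; [split|rewrite /unit_segm /= in_itv/=; lra].
  - by rewrite subrr expr0n.
rewrite /error_bound.
move: err cap h; set L := lorentz_sum _ _ _; set a := psi2 _ _ _; set b := psi3 _ _ _.
set K := capinv _ _; set A := (z.2 < t)%R%:R; set B := (0 < t)%R%:R.
have -> : a - B = (a - A) + (A - B) by ring.
have := sqr_ge0 ((a - A) - (A - B)); have := sqr_ge0 b.
move=> *; have : (a - A + (A - B)) ^+ 2 <= 2 * (a - A) ^+ 2 + 2 * (A - B) ^+ 2 by nra.
lra.
Qed.

Lemma continuous_error_bound : continuous (fun x : R3 => error_bound x.1.2 x.2).
Proof.
have cc (c : R) : continuous (fun _ : R3 => c) by move=> x; exact: cvg_cst.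
have c2 : continuous (fun x : R3 => x.1.2).
  by move=> x; exact: (cvg_comp _ _ (@cvg_fst _ _ _ _ _) (@cvg_snd _ _ _ _ _)).
have cb : continuous (fun x : R3 => `|x.2 - z.2| + r).
  apply: continuous_addf; last exact: cc.
  apply: (@continuous_app _ R3 (fun u : R => `|u|)); first exact: norm_continuous.
  by apply: continuous_addf; [move=> x; exact: cvg_snd|exact: cc].
have cl (c : R) :
    continuous (fun x : R3 => ((x.1.2 - c) ^+ 2 + (`|x.2 - z.2| + r) ^+ 2)^-1).
  move=> x; apply: cvgV; first by rewrite gt_eqF// sqrD_gt0// shifted_abs_gt0.
  have h1 : continuous (fun x : R3 => x.1.2 - c) by apply: continuous_addf.
  exact: (cvgD (cvgM (h1 x) (h1 x)) (cvgM (cb x) (cb x))).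
apply: continuous_mulf; first exact: cc.
by apply: continuous_addf; [apply: continuous_addf|]; exact: cl.
Qed.

Lemma error_bound_slice t :
  (\int[lam]_(s in `[0%R, 1%R]) (error_bound s t)%:E <= (480 * decay r (t - z.2))%:E)%E.
Proof.
have b0 := shifted_abs_gt0 t; rewrite /error_bound /lorentz_sum.
have ml (c : R) : measurable_fun (`[0, 1]%classic : set R)
    (fun s : R => (((s - c) ^+ 2 + (`|t - z.2| + r) ^+ 2)^-1)%:E).
  apply/measurable_EFinP; apply: measurable_funTS.
  by apply: continuous_measurable_fun; exact: continuous_lorentz.
have pos (c s : R) : (0 <= (((s - c) ^+ 2 + (`|t - z.2| + r) ^+ 2)^-1)%:E)%E.
  by rewrite lee_fin lorentz_ge0.
have md : measurable_fun (`[0, 1]%classic : set R) (fun s : R =>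
    (((s - (z.1 - 1)) ^+ 2 + (`|t - z.2| + r) ^+ 2)^-1
     + ((s - z.1) ^+ 2 + (`|t - z.2| + r) ^+ 2)^-1)%:E).
  by apply/measurable_EFinP; apply: measurable_funD; apply/measurable_EFinP; exact: ml.
have mt : measurable_fun (`[0, 1]%classic : set R) (fun s : R =>
    (((s - (z.1 - 1)) ^+ 2 + (`|t - z.2| + r) ^+ 2)^-1
     + ((s - z.1) ^+ 2 + (`|t - z.2| + r) ^+ 2)^-1
     + ((s - (z.1 + 1)) ^+ 2 + (`|t - z.2| + r) ^+ 2)^-1)%:E).
  apply/measurable_EFinP; apply: measurable_funD; apply/measurable_EFinP => //.
  exact: ml.
under eq_integral do rewrite EFinM.
rewrite ge0_integralZl//; last by move=> s _; rewrite lee_fin !addr_ge0 ?lorentz_ge0.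
under eq_integral do rewrite EFinD.
rewrite ge0_integralD//; last 2 first.
- by move=> s _; rewrite lee_fin addr_ge0 ?lorentz_ge0.
- exact: ml.
under eq_integral do rewrite EFinD.
rewrite ge0_integralD//; [|exact: ml..].
have -> : 480 * decay r (t - z.2) = 32 * (5 * decay r (t - z.2) + 5 * decay r (t - z.2)
    + 5 * decay r (t - z.2)) by ring.
rewrite EFinM lee_wpmul2l ?lee_fin// EFinD; apply: leeD; last exact: lorentz_integral.
by rewrite EFinD; apply: leeD; exact: lorentz_integral.
Qed.

Lemma measurable_unit_cube : measurable (unit_cube : set measR3).
Proof.
by apply: measurableX; [apply: measurableX|]; exact: measurable_unit_segm.
Qed.

Lemma lebesgue_unit_cube : lebesgue3 R unit_cube = 1%E.
Proof.
have mu := @measurable_unit_segm R.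
by rewrite /unit_cube lebesgue3_box// !lebesgue_unit_segm !mule1.
Qed.

Lemma psi_error_L2 (D : set R3) : D `<=` @cylZ R ->
  (L2norm D (embedC (psi z w) \- @upper_e2 R)%R <=
   (Num.sqrt (960 * (ln (r + 1) - ln r) + 2))%:E)%E.
Proof.
move=> DZ; apply: (L2norm_le (g := fun x =>
  \1_unit_cell x * error_bound x.1.2 x.2 + 2 * \1_unit_cube x)).
- by move=> x; rewrite addr_ge0// mulr_ge0// error_bound_ge0.
- by move=> x /DZ; exact: psi_error_le.
have mc : measurable_fun setT (\1_unit_cell : measR3 -> R).
  by apply: measurable_indic; exact: measurable_unit_cell.
have mq : measurable_fun setT (\1_unit_cube : measR3 -> R).
  by apply: measurable_indic; exact: measurable_unit_cube.
under eq_integral do rewrite EFinD.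
rewrite ge0_integralD; first last.
- by apply/measurable_EFinP; apply: measurable_funM.
- by move=> x _; rewrite lee_fin mulr_ge0.
- apply/measurable_EFinP; apply: measurable_funM => //.
  by apply: continuous_measurable3; exact: continuous_error_bound.
- by move=> x _; rewrite lee_fin mulr_ge0// error_bound_ge0.
- by [].
rewrite EFinD; apply: leeD.
  apply: le_trans (cell_integral_le (h := fun t => 480 * decay r (t - z.2)) _ _ _) _.
  - exact: continuous_error_bound.
  - exact: error_bound_ge0.
  - exact: error_bound_slice.
  under eq_integral do rewrite EFinM.
  rewrite ge0_integralZl; first last.
  - by rewrite lee_fin ler0n.
  - by move=> t _; rewrite lee_fin decay_ge0.
  - apply/measurable_EFinP; apply: continuous_measurable_fun => t.
    have h : (fun t => t - z.2) @ t --> t - z.2.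
      by apply: cvgB; [exact: cvg_id|exact: cvg_cst].
    exact: (cvg_comp _ _ h (continuous_decay r0 (x := _))).
  - exact: measurableT.
  by rewrite decay_integral// -EFinM lee_fin; lra.
under eq_integral do rewrite EFinM.
rewrite ge0_integralZl//; last exact/measurable_EFinP.
rewrite integral_indic//; last exact: measurable_unit_cube.
by rewrite setIT [X in (_ * X)%E]lebesgue_unit_cube mule1.
Qed.

(** In the open cell the cylinder over the disc meets the complement of the wire in [I] times
   the disc, and this box replaces the disc by a square. *)
Definition gap_box (I : set R) : set R3 :=
  (I `*` `[z.1 - r, z.1 + r]%classic) `*` `[z.2 - r, z.2 + r]%classic.

Lemma curl_psi_le (I : set R) (x : R3) : cylZ x -> ~ wire z r I x ->
  enorm (embedC (curl_psi z w) x) ^+ 2 <= (24 / w) ^+ 2 * \1_(gap_box I) x.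
Proof.
case: x => [[x1 s] t] [/= /andP[a1 b1] /andP[s0 s1]] xw.
rewrite enorm_embedC sqr_sqrtr; last first.
  by apply: sumr_ge0 => k _; exact: sqr_ge0.
rewrite sum3E /curl_psi /= expr0n !addr0 psi_curl//.
set p := angle2 _ _; set q := angle3 _ _.
have pos : 0 <= (24 / w) ^+ 2 * \1_(gap_box I) (x1, s, t).
  by rewrite mulr_ge0// sqr_ge0.
have [wW|Ww] := leP w (potential p q).
  by rewrite /capped_potential max_l// subrr mulr0 mul0r oppr0 mulr0 expr0n.
have st : disc r z (s, t).
  by apply: (disc_of_potential z1 r0 rz rz1) => //; rewrite s0 s1.
have Ix : I x1.
  apply: contrapT => nI; apply: xw; split => //; split=> //.
  by rewrite /= in_itv/= a1 b1.
have -> : \1_(gap_box I) (x1, s, t) = 1 :> R.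
  rewrite indicE mem_set//; move: st; rewrite /disc /= => st.
  have := sqr_ge0 (s - z.1); have := sqr_ge0 (t - z.2) => ? ?.
  have : `|s - z.1| <= r.
    by rewrite -ler_sqr ?nnegrE ?normr_ge0 ?(ltW r0)// real_normK ?num_real//; lra.
  have : `|t - z.2| <= r.
    by rewrite -ler_sqr ?nnegrE ?normr_ge0 ?(ltW r0)// real_normK ?num_real//; lra.
  rewrite !ler_norml => /andP[? ?] /andP[? ?].
  by split; [split=> //|]; rewrite /= in_itv/=; lra.
rewrite mulr1 /capped_potential max_r ?(ltW Ww)// mulrN sqrrN.
have w0' := w0.
have W0 := potential_ge0 p q.
have w1 : w <= 1 by have := threshold_le1 r0 rz rz1; rewrite /w; lra.
have c1 := cos_geN1 p; have c2 := cos_le1 p; have ch := cosh_ge1 q.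
have P4 : @pi R <= 4 by have := @pihalf_lt2 R; lra.
have P0 := @pi_ge0 R.
(* Here cosh q < w + cos p, so the factor multiplying [w - potential p q] is bounded. *)
have cc : cos p + cosh q <= 3.
  by move: (ltW Ww); rewrite /potential; lra.
have cw : (cos p + cosh q) * (w - potential p q) <= 3 * w by nra.
have cw0 : 0 <= (cos p + cosh q) * (w - potential p q) by rewrite mulr_ge0; lra.
have -> : 24 / w = 24 * w / w ^+ 2 by field; rewrite gt_eqF.
rewrite mulrA ler_sqr ?nnegrE.
- by rewrite ler_wpM2r ?invr_ge0 ?sqr_ge0//; nra.
- by rewrite divr_ge0 ?sqr_ge0// mulr_ge0// mulr_ge0.
- by rewrite divr_ge0 ?sqr_ge0// mulr_ge0// ltW.
Qed.

Lemma curl_psi_L2 (I : set R) m : measurable I -> lam I = m%:E ->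
  (L2norm (@cylZ R `\` wire z r I) (embedC (curl_psi z w)) <=
   (Num.sqrt (96 ^+ 2 * (r ^- 2 * m)))%:E)%E.
Proof.
move=> mI Im; apply: (L2norm_le (g := fun x => (24 / w) ^+ 2 * \1_(gap_box I) x)).
- by move=> x; rewrite mulr_ge0// sqr_ge0.
- by move=> x [xZ xw]; exact: curl_psi_le.
have mB : measurable (gap_box I : set measR3).
  by apply: measurableX => //; exact: measurableX.
under eq_integral do rewrite EFinM.
rewrite ge0_integralZl//; last 2 first.
- by apply/measurable_EFinP/measurable_indic.
- by rewrite lee_fin sqr_ge0.
rewrite integral_indic// setIT.
have -> : lebesgue3 R (gap_box I) = (4 * m * r ^+ 2)%:E.
  rewrite /gap_box lebesgue3_box// Im !lebesgue_measure_itv/= !lte_fin.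
  have -> : z.1 - r < z.1 + r by move: r0 => ?; lra.
  have -> : z.2 - r < z.2 + r by move: r0 => ?; lra.
  by rewrite -!EFinB -!EFinM; congr (_%:E); ring.
rewrite -EFinM lee_fin.
have -> : (24 / w) ^+ 2 * (4 * m * r ^+ 2) = 96 ^+ 2 * (r ^- 2 * m).
  by rewrite /w /threshold; field; rewrite gt_eqF.
exact: lexx.
Qed.

End energy_bounds.

(** * Passage to the limit *)
Section limits.
Context {R : realType}.

Lemma measurable_finite_union (I : set R) :
  finite_union_open_intervals I -> measurable I.
Proof.
move=> [s ->]; apply: fin_bigcup_measurable; first exact: finite_seq.
by move=> p _; exact: measurable_itv.
Qed.

Lemma cvg_sqrt_norm (c B : nat -> R) (N : nat -> \bar R) :
  (forall n, 0 <= c n) -> (forall n, (0 <= N n)%E) ->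
  (forall n, (N n <= (Num.sqrt (B n))%:E)%E) ->
  c n * B n @[n --> \oo] --> (0 : R) ->
  ((Num.sqrt (c n))%:E * N n)%E @[n --> \oo] --> 0%E.
Proof.
move=> c0 N0 NB cB.
apply: (@squeeze_cvge _ _ _ _ (fun _ => 0%E) _ (fun n => (Num.sqrt (c n * B n))%:E)).
- apply: nearW => n; rewrite mule_ge0 ?lee_fin ?sqrtr_ge0//=.
  by rewrite sqrtrM// EFinM lee_wpmul2l ?lee_fin ?sqrtr_ge0.
- exact: cvg_cst.
- apply: cvg_EFin; first exact: nearW.
  rewrite -[X in _ --> X](@sqrtr0 R).
  exact: (cvg_comp _ _ cB (@sqrt_continuous R 0)).
Qed.

Lemma log_ratio_le (r : R) : 0 < r -> r <= 1 -> ln (r + 1) - ln r <= 1 + `|ln r|.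
Proof.
move=> r0 r1; apply: lerD; last by rewrite -normrN ler_norm.
by rewrite addrC (le_trans (le_ln1Dx _))//; lra.
Qed.

End limits.

Theorem proposition6p5 (R : realType) (z0 : R * R) (R0 : R)
    (hz0 : 0 < z0.1 < 1 /\ 0 < z0.2 < 1) (hR0 : 0 < R0)
    (hdisc : closure (disc R0 z0) `<=` `]0, 1[ `*` `]0, 1[)
    (eta r : nat -> R) (I : nat -> set R)
    (eta_gt0 : forall n, 0 < eta n)
    (eta_cvg0 : eta n @[n --> \oo] --> 0)
    (hr : forall n, 0 < r n <= R0)
    (hI : forall n, finite_union_open_intervals (I n))
    (hI01 : forall n, I n `<=` `]0, 1[)
    (hlog : eta n * `|ln (r n)| @[n --> \oo] --> 0)
    (hgap : (((eta n)^-1 * (r n) ^- 2)%:E * lebesgue_measure (I n))%E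
              @[n --> \oo] --> 0%E) :
  asymptotically_connecting_e1 eta (fun n => wire z0 (r n) (I n)).
Proof.
case: hz0 => hz1 hz2; have [m1 m2] := disc_margin hR0 hdisc.
have r0 n : 0 < r n by have /andP[] := hr n.
have rz n : r n <= z0.1 by have /andP[_ /le_trans] := hr n; apply.
have rz1 n : r n <= 1 - z0.1 by have /andP[_ /le_trans] := hr n; apply.
have r1 n : r n <= 1 by have := rz n; case/andP: hz1; lra.
have mI n : measurable (I n) by exact: measurable_finite_union.
pose m n : R := fine (lebesgue_measure (I n)).
have Im n : lebesgue_measure (I n) = (m n)%:E.
  rewrite fineK// ge0_fin_numE//.
  apply: (@le_lt_trans _ _ (lebesgue_measure (`]0, 1[%classic : set R))).
    by apply: le_measure; rewrite ?inE; [exact: mI|exact: measurable_itv|exact: hI01].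
  by rewrite lebesgue_measure_itv/= lte_fin ltr01 -EFinB ltry.
exists (fun n => embedC (psi z0 (threshold (r n)))),
  (fun n => embedC (curl_psi z0 (threshold (r n)))).
split.
- by move=> n; apply: psi_Hdot_per_curl; exact: threshold_gt0.
- by move=> n; apply: is_curl_subset; apply: is_curl_psi; exact: threshold_gt0.
- apply: (@cvg_sqrt_norm _ _ (fun n => 962 + 960 * `|ln (r n)|)).
  + by move=> n; exact: ltW.
  + by move=> n; exact: Lnorm_ge0.
  + move=> n; apply: le_trans (psi_error_L2 hz1 hz2 (r0 n) (rz n) (rz1 n) _) _.
      by move=> x [].
    rewrite lee_fin ler_wsqrtr//; have := log_ratio_le (r0 n) (r1 n); lra.
  + have h : eta n * 962 + 960 * (eta n * `|ln (r n)|) @[n --> \oo]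
        --> (0 * 962 + 960 * 0 : R).
      by apply: cvgD; apply: cvgM => //; exact: cvg_cst.
    have -> : (fun n => eta n * (962 + 960 * `|ln (r n)|)) =
        (fun n => eta n * 962 + 960 * (eta n * `|ln (r n)|)).
      by apply/funext => n; ring.
    by move: h; rewrite mul0r mulr0 addr0.
- have -> : (fun n => ((Num.sqrt (eta n))^-1%:E *
     L2norm (@cylZ R `\` wire z0 (r n) (I n)) (embedC (curl_psi z0 (threshold (r n)))))%E) =
    (fun n => ((Num.sqrt ((eta n)^-1))%:E *
     L2norm (@cylZ R `\` wire z0 (r n) (I n)) (embedC (curl_psi z0 (threshold (r n)))))%E).
    by apply/funext => n; rewrite sqrtrV// ltW.
  apply: (@cvg_sqrt_norm _ _ (fun n => 96 ^+ 2 * (r n ^- 2 * m n))).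
  + by move=> n; rewrite invr_ge0 ltW.
  + by move=> n; exact: Lnorm_ge0.
  + by move=> n; exact: (curl_psi_L2 hz1 (r0 n) (rz n) (rz1 n) (mI n) (Im n)).
  + have g0 : (eta n)^-1 * r n ^- 2 * m n @[n --> \oo] --> (0 : R).
      move: hgap; under eq_fun do rewrite Im -EFinM.
      by move/fine_cvg.
    have h : 96 ^+ 2 * ((eta n)^-1 * r n ^- 2 * m n) @[n --> \oo] --> (96 ^+ 2 * 0 : R).
      by apply: cvgM => //; exact: cvg_cst.
    have -> : (fun n => (eta n)^-1 * (96 ^+ 2 * (r n ^- 2 * m n))) =
        (fun n => 96 ^+ 2 * ((eta n)^-1 * r n ^- 2 * m n)).
      by apply/funext => n; rewrite mulrCA [X in _ * X]mulrA.
    by move: h; rewrite mulr0.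
Qed.
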